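(* For every integer $n\ge1$, $$\zeta_{0,n}\;\ge\;\frac1{2^{n-1}}.$$
   Context: All homology groups have coefficients in $\mathbb{Z}/2$ and $b_i$ denotes the $i$-th Betti number. For an integer $m\ge1$, $X_m^n$ denotes a nonsingular real algebraic hypersurface of degree $m$ in $\mathbb{C}P^n$, i.e. the zero locus in $\mathbb{C}P^n$ of a homogeneous polynomial of degree $m$ in $n+1$ variables with real coefficients; $\mathbb{R}X_m^n\subset\mathbb{R}P^n$ is its real part. $\mathrm{Max}\,b_i(\mathbb{R}X_m^n)$ is the maximum of $b_i(\mathbb{R}X_m^n)$ over all such hypersurfaces, for $i,m,n$ fixed. One sets $$\zeta_{i,n}=\lim_{m\to+\infty}\frac{\mathrm{Max}\,b_i(\mathbb{R}X_m^n)}{m^n};$$ this limit exists. *)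

(* Defs.v *)
From HB Require Import structures.
From mathcomp Require Import all_boot all_order all_algebra.
From mathcomp Require Import all_classical all_reals all_analysis.
From mathcomp.multinomials Require Import freeg.
(* The notations of mpoly clash with those of MathComp-Analysis. *)
From mathcomp.multinomials Require Import -(notations) mpoly.
From mathcomp.real_closed Require Import complex.

Set Implicit Arguments.
Unset Strict Implicit.
Unset Printing Implicit Defensive.

Import Order.TTheory GRing.Theory Num.Theory.
Import numFieldNormedType.Exports.

Local Open Scope classical_set_scope.
Local Open Scope ring_scope.
Local Open Scope quotient_scope.

Section SingularHomology.
Variable R : realType.

Definition std_simplex (k : nat) : set 'rV[R]_k.+1 :=
  [set t | (forall l, 0 <= t 0 l) /\ \sum_l t 0 l = 1].

Definition face_row (k : nat) (j : 'I_k.+2) (t : 'rV[R]_k.+1) : 'rV[R]_k.+2 :=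
  \row_l (if unlift j l is Some l' then t 0 l' else 0).

Lemma face_row_simplex (k : nat) (j : 'I_k.+2) (t : 'rV[R]_k.+1) :
  @std_simplex k t -> @std_simplex k.+1 (face_row j t).
Proof.
move=> [t0 t1]; split=> [l|].
  by rewrite mxE; case: unliftP => [l'|] _.
rewrite (bigD1_ord j)//= mxE unlift_none add0r -[RHS]t1.
by apply: eq_bigr => l _; rewrite mxE liftK.
Qed.

Definition face (k : nat) (j : 'I_k.+2) (t : @std_simplex k) :
    @std_simplex k.+1 :=
  SigSub (mem_set (face_row_simplex j (set_valP t))).

Lemma face_row_continuous (k : nat) (j : 'I_k.+2) :
  continuous (@face_row k j).
Proof.
move=> t A [P tP sPA].
exists (fun i l' => P i (fintype.lift j l')).
  by move=> i l'; have := tP i (fintype.lift j l'); rewrite mxE liftK (ord1 i).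
move=> s sP; apply: sPA => i l; rewrite /face_row mxE.
have := tP i l; rewrite mxE; case: unliftP => [l' ->|_] Pl.
  by have := sP i l'; rewrite (ord1 i).
exact: nbhs_singleton Pl.
Qed.

Lemma face_continuous (k : nat) (j : 'I_k.+2) : continuous (@face k j).
Proof.
apply: continuous_comp_initial => t.
have -> : set_val \o face j = face_row j \o set_val by [].
apply: continuous_comp; first exact: initial_continuous.
exact: face_row_continuous.
Qed.

HB.instance Definition _ (k : nat) (j : 'I_k.+2) :=
  @isContinuous.Build _ _ (@face k j) (@face_continuous k j).

Variable X : topologicalType.

Notation singular_simplex k := (continuousType (@std_simplex k) X).

Notation chain k := {freeg (singular_simplex k) / 'F_2}.

(* The signs of the faces are immaterial modulo 2. *)
Definition boundary (k : nat) : chain k.+1 -> chain k :=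
  fglift (fun s : singular_simplex k.+1 =>
    \sum_(j < k.+2) << (s \o face j : singular_simplex k) >>).

Definition cycle (i : nat) : chain i -> Prop :=
  if i is k.+1 then fun c => boundary c = 0 else fun=> True.

Definition homologous (i : nat) (c c' : chain i) : Prop :=
  exists d : chain i.+1, c - c' = boundary d.

(* [betti i b]: the vector space H_i(X; Z/2) = cycles modulo boundaries has a
   basis of [b] elements, namely the classes of the [e j]. *)
Definition betti (i b : nat) : Prop :=
  exists e : 'I_b -> chain i,
    (forall j, cycle (e j)) /\
    (forall c, cycle c ->
      exists! a : {ffun 'I_b -> 'F_2}, homologous c (\sum_j a j *: e j)).

End SingularHomology.

Section RealProjectiveSpace.
Variables (R : realType) (n : nat).

Definition nonzero_vector : set 'rV[R]_n.+1 := [set v | v != 0].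

Definition proportional (v w : nonzero_vector) : bool :=
  `[< exists2 a : R, a != 0 & set_val v = a *: set_val w >].

Lemma proportional_equiv : equiv_class_of proportional.
Proof.
split=> [v|v w|w v u].
- by apply/asboolP; exists 1; rewrite ?oner_neq0 ?scale1r.
- by apply/asboolP/asboolP => -[a a0 ->]; exists a^-1;
    rewrite ?invr_eq0 ?scalerA ?mulVf ?scale1r.
- move=> /asboolP[a a0 vw] /asboolP[b b0 wu]; apply/asboolP.
  by exists (a * b); rewrite ?mulf_neq0// vw wu scalerA.
Qed.

Canonical proportional_equivRel := EquivRelPack proportional_equiv.

Definition RP : topologicalType :=
  quotient_topology {eq_quot proportional}.

End RealProjectiveSpace.

Section Hypersurface.
Variables (R : realType) (n : nat).
Implicit Type f : mpoly n.+1 R.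

Definition complexify f : mpoly n.+1 R[i] :=
  map_mpoly (real_complex R) f.

(* The hypersurface of CP^n defined by [f] has no singular point. *)
Definition nonsingular f : Prop :=
  forall z : 'I_n.+1 -> R[i], (exists l, z l != 0) ->
    meval z (complexify f) = 0 ->
    exists l, meval z (mderiv l (complexify f)) != 0.

Definition real_part f : set (RP R n) :=
  [set \pi_(RP R n) v | v in
    [set v : @nonzero_vector R n | meval (set_val v 0) f = 0]].

Definition hypersurface (m : nat) f : Prop :=
  f \is ishomog1 m mdeg /\ nonsingular f.

Definition betti_values (i m : nat) : set nat :=
  [set b | exists2 f, hypersurface m f & betti R (real_part f) i b].

Definition is_max_betti (i m M : nat) : Prop :=
  betti_values i m M /\ ubound (betti_values i m) M.

End Hypersurface.

(* [is_zeta i n z]: the limit defining zeta_{i,n} is [z]. *)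
Definition is_zeta (R : realType) (i n : nat) (z : R) : Prop :=
  exists2 M : nat -> nat,
    forall m, (0 < m)%N -> is_max_betti R n i m (M m) &
    (M m)%:R / m%:R ^+ n @[m --> \oo] --> z.

(* Main.v *)
Require Import Defs.
From mathcomp Require Import all_boot all_order all_algebra.
From mathcomp Require Import all_classical all_reals all_analysis.
Import Order.TTheory GRing.Theory Num.Theory.
Local Open Scope ring_scope.
From HB Require Import structures.
From mathcomp.multinomials Require Import freeg.
From mathcomp.multinomials Require Import -(notations) mpoly.
From mathcomp.real_closed Require Import complex.
From mathcomp Require Import ring lra zify.
From mathcomp Require cyclic separable cyclotomic.
Set Implicit Arguments.
Unset Strict Implicit.
Unset Printing Implicit Defensive.
Import numFieldNormedType.Exports.
Local Open Scope classical_set_scope.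
Local Open Scope ring_scope.

(** The limit may be computed along the odd degrees m = 2 q + 1, and it is
    enough to find for every q > 0 a nonsingular hypersurface of degree m
    whose real part has at least (2 q - 1) q^(n - 1) components: divided by
    m^n, this number tends to 1 / 2^(n - 1).

    Components are recognized by boxes. In the chart X_0 = 1, call a box
    isolating for a form f if f takes both signs in it and does not vanish
    on its boundary. Zeros of f in distinct disjoint isolating boxes cannot
    be joined within the zero locus, and the real part of a nonsingular
    hypersurface, being compact and locally path connected, has finitely
    many components; so its zeroth Betti number exists and is at least the
    number of boxes ([finite_classes], [components_lower_bound]). Isolating
    boxes resist small perturbations ([isolating_box_near]), and f + c
    (X_0^m + ... + X_n^m) is nonsingular for all but finitely many c,
    because the monomials at a singular point are an eigenvector, of
    eigenvalue - c m, of a matrix that depends on f only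
    ([fermat_perturbation]). Hence f itself is allowed to be singular.

    For n = 1 the form is the Chebyshev polynomial T_m. For n = J + 2, with
    coordinates x, y, z_1, ..., z_J in the chart, it is
      f = g (x, y) + d (h (x, y) + T_m (z_1) + ... + T_m (z_J)), d > 0 small.

    Here g = 0 is the image of the line u + v = 1 under (u, v) |-> (u^m,
    v^m), that is, g is the norm of y - (1 - t)^m for the extension t^m = x.
    Besides the arc traced by the real points of the line, and away from x =
    0, the real zeros of g are (m - 1)(m - 2) / 2 solitary points, the
    images of the pairs of conjugate nonreal t for which t^m and (1 - t)^m
    are both real. The sign of g changes across the arc only, so a solitary
    point is a strict local minimum of g above the arc and a strict local
    maximum below it ([solitary_nodes]).

    To make wells out of minima and maxima alike, h has degree at most m - 3
    and takes the value J - 1/2 at the minima and - (J - 1/2) at the maxima.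
    Such an h exists because polynomials of that degree are as many as the
    solitary points, and one that vanishes at all of them vanishes on the
    parametrized curve, having too many zeros for its degree, hence is zero
    ([interpolation]). Over a minimum, choose for every z_j one of the q
    interior minima of T_m. At the chosen point f is d (J - 1/2 - J) < 0. On
    the boundary of a box around it, either (x, y) has left the solitary
    point and g > 0 dominates, or some z_j is a zero of T_m and the factor
    of d exceeds J - 1 - (J - 1) = 0 ([well_isolating]). Over a maximum all
    signs are opposite, and T_m has q interior maxima as well. This gives q
    (2 q - 1) q^J = (2 q - 1) q^(n - 1) isolating boxes. *)

(** * Zeroth homology modulo 2 *)

Section ZerothHomology.
Variables (R : realType) (X : topologicalType).
Local Notation simplex k := (continuousType (@std_simplex R k) X).
Local Notation chain k := {freeg (simplex k) / 'F_2}.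

HB.instance Definition _ k :=
  GRing.isAdditive.Build _ _ (@boundary R X k) (@lift_is_additive _ _ _ _).

Definition endpoint (j : 'I_2) (s : simplex 1) : simplex 0 := s \o face j.

Definition linked (s s' : simplex 0) : Prop :=
  homologous (<< s >> : chain 0) << s' >>.

Definition end_invariant (P : pred (simplex 0)) : Prop :=
  forall s : simplex 1, P (endpoint ord0 s) = P (endpoint ord_max s).

(** The functionals that detect homology classes of 0-cycles: for a union [P] of
    path components, the number modulo 2 of points of a chain that lie in it. *)
Definition parity (P : pred (simplex 0)) (c : chain 0) : 'F_2 :=
  fglift (fun s => (P s)%:R : ('F_2)^o) c.

HB.instance Definition _ P :=
  GRing.isAdditive.Build _ _ (parity P)
    (@lift_is_additive _ _ ('F_2)^o (fun s => (P s)%:R : ('F_2)^o)).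

Lemma parityU P s : parity P << s >> = (P s)%:R.
Proof. by rewrite /parity liftU scale1r. Qed.

Lemma F2_cases (a : 'F_2) : a = 0 \/ a = 1.
Proof. by case: a => -[|[|//]] lt; [left|right]; apply: val_inj. Qed.

Lemma chain_ind k (Q : chain k -> Prop) :
  Q 0 -> (forall s c, Q c -> Q (<< s >> + c)) -> forall c, Q c.
Proof.
move=> Q0 QS c; rewrite -[c]freeg_sumE.
elim/big_rec: _ => // s c' _ Qc'.
by case: (F2_cases (coeff s c)) => ->; [rewrite freegU0 add0r|exact: QS].
Qed.

Lemma boundaryU (s : simplex 1) :
  boundary (<< s >> : chain 1) =
  << endpoint ord0 s >> + << endpoint ord_max s >>.
Proof.
rewrite /boundary liftU scale1r big_ord_recl big_ord1.
by congr (_ + << _ >>); apply/continuousEP => t; rewrite /endpoint/=;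
  congr (s (face _ t)); apply: val_inj.
Qed.

Lemma addrr_F2 (a : 'F_2) : a + a = 0.
Proof. by case: (F2_cases a) => ->; apply: val_inj. Qed.

(** The two ends of a 1-simplex lie on the same side of [P], so its boundary
    contributes an even number. *)
Lemma parity_boundary P d : end_invariant P -> parity P (boundary d) = 0.
Proof.
move=> Pinv; elim/chain_ind: d => [|s d IH]; first by rewrite !raddf0.
by rewrite !raddfD/= IH addr0 boundaryU raddfD/= !parityU Pinv addrr_F2.
Qed.

Lemma homologous_refl k (c : chain k) : homologous c c.
Proof. by exists 0; rewrite subrr raddf0. Qed.

Lemma homologous_sym k (c c' : chain k) : homologous c c' -> homologous c' c.
Proof. by move=> [d e]; exists (- d); rewrite raddfN/= -e opprB. Qed.

Lemma homologous_trans k (c c' c'' : chain k) :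
  homologous c c' -> homologous c' c'' -> homologous c c''.
Proof.
move=> [d e] [d' e']; exists (d + d').
by rewrite raddfD/= -e -e' addrA subrK.
Qed.

Lemma homologousD k (c c' d d' : chain k) :
  homologous c c' -> homologous d d' -> homologous (c + d) (c' + d').
Proof.
move=> [a e] [b e']; exists (a + b).
by rewrite [boundary _]raddfD/= -e -e' opprD addrACA.
Qed.

Lemma parity_homologous P c c' : end_invariant P ->
  homologous c c' -> parity P c = parity P c'.
Proof.
move=> Pinv [d e]; apply/eqP; rewrite -subr_eq0 -raddfB/= e.
by rewrite parity_boundary.
Qed.

Lemma linked_invariant P s s' : end_invariant P -> linked s s' -> P s = P s'.
Proof.
move=> Pinv /(parity_homologous Pinv); rewrite !parityU.
by case: (P s); case: (P s').
Qed.

Lemma linked_ends (s : simplex 1) :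
  linked (endpoint ord0 s) (endpoint ord_max s).
Proof.
exists << s >>; rewrite boundaryU; congr (_ + _).
rewrite freegUN; congr [freeg [:: (_, _)]]; exact: val_inj.
Qed.

Lemma linked_class_invariant e : end_invariant (fun s => `[< linked s e >]).
Proof.
move=> s; apply/asboolP/asboolP; apply: homologous_trans.
  exact/homologous_sym/linked_ends.
exact: linked_ends.
Qed.

(** The parities of the classes of the [e i] are the coordinates of a chain in
    the basis [e]: their existence is the covering hypothesis, extended from
    points to chains, and their uniqueness is the homology invariance of
    parities. *)
Lemma betti0_representatives b (e : 'I_b -> simplex 0) :
  (forall s, exists i, linked s (e i)) ->
  (forall i j, linked (e i) (e j) -> i = j) ->
  betti R X 0 b.
Proof.
move=> cover inj; exists (fun i => << e i >>); split=> // c _.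
pose P i s := `[< linked s (e i) >].
have Pinv i : end_invariant (P i) by exact: linked_class_invariant.
have parity_sum i (a : {ffun 'I_b -> 'F_2}) :
    parity (P i) (\sum_j a j *: << e j >>) = a i.
  rewrite raddf_sum/= (bigD1 i)//= big1 ?addr0 => [|j ji].
    case: (F2_cases (a i)) => ->; first by rewrite scale0r raddf0.
    by rewrite scale1r parityU /P asboolT//; apply: homologous_refl.
  case: (F2_cases (a j)) => ->; first by rewrite scale0r raddf0.
  rewrite scale1r parityU /P asboolF// => /inj ij.
  by rewrite ij eqxx in ji.
exists [ffun i => parity (P i) c]; split; last first.
  by move=> a /(parity_homologous (Pinv _)) h; apply/ffunP => i;
    rewrite ffunE h parity_sum.
elim/chain_ind: c => [|s c IH].
  rewrite big1 => [|i _]; first exact: homologous_refl.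
  by rewrite ffunE raddf0 scale0r.
have [i si] := cover s.
under eq_bigr do rewrite ffunE raddfD/= scalerDl.
rewrite big_split/=; apply: homologousD; last first.
  by under eq_bigr do [rewrite -(ffunE (fun i => parity (P i) c))].
rewrite (bigD1 i)//= big1 ?addr0 => [|j ji].
  by rewrite parityU /P asboolT// scale1r.
rewrite parityU /P asboolF ?scale0r// => sj.
move/eqP: ji; apply; apply: inj.
exact: homologous_trans (homologous_sym sj) si.
Qed.

(** Finitely many points that meet every class bound the number of classes, so
    that one representative per class is a finite basis, at least as long as any
    family of pairwise non-homologous points. *)
Lemma betti0_finite_classes (es : seq (simplex 0)) (K : finType)
    (u : K -> simplex 0) :
  (forall s, exists2 e, e \in es & linked s e) ->
  (forall i j, linked (u i) (u j) -> i = j) ->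
  exists2 b, (#|K| <= b)%N & betti R X 0 b.
Proof.
move=> cover uinj.
pose P s s' := `[< linked s s' >].
pose rep s := choose (P s) s.
have linkedC s : linked s (rep s).
  apply/asboolP; rewrite -/(P s _); apply: chooseP.
  exact/asboolP/homologous_refl.
have rep_eq s s' : linked s s' -> rep s = rep s'.
  move=> ss'; rewrite /rep (@eq_choose _ (P s) (P s')) => [|t].
    apply: choose_id; last exact/asboolP/homologous_refl.
    exact/asboolP/homologous_sym.
  apply/asboolP/asboolP; apply: homologous_trans => //.
  exact: homologous_sym.
have eq_rep s s' : rep s = rep s' -> linked s s'.
  move=> ss'; apply: homologous_trans (linkedC s) _.
  by rewrite -/(linked _ _) ss'; exact/homologous_sym/linkedC.
pose rs := undup (map rep es).
have rep_rs s : rep s \in rs.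
  have [e ees /rep_eq ->] := cover s.
  by rewrite mem_undup map_f.
have rs_rep s : s \in rs -> rep s = s.
  by rewrite mem_undup => /mapP[e _ ->]; apply/esym/rep_eq/linkedC.
exists (size rs).
  rewrite cardE -(size_map (rep \o u)); apply: uniq_leq_size.
    rewrite map_inj_uniq ?enum_uniq// => i j /= /eq_rep.
    exact: uinj.
  by move=> _ /mapP[i _ ->]; apply: rep_rs.
apply: (@betti0_representatives _ (fun i => tnth (in_tuple rs) i)) => [s|i j].
  have /(tnthP (in_tuple rs))[i rsi] := rep_rs s.
  by exists i; rewrite -rsi.
move=> /rep_eq; rewrite !rs_rep ?mem_tnth// => /tuple_uniqP; apply.
exact: undup_uniq.
Qed.

End ZerothHomology.

(** * Nonsingular perturbations *)

Section FermatPerturbation.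
Variables (K : closedFieldType) (n m : nat).
Hypothesis m_neq0 : m%:R != 0 :> K.
Implicit Types (f : mpoly n.+1 K) (z : 'I_n.+1 -> K).

Definition fermat (A : nzRingType) : mpoly n.+1 A :=
  \sum_l mpolyX A (mnm_muln (mnm1 l) m).

Lemma mderiv_fermat l :
  mderiv l (fermat K) = m%:R *: mpolyX K (mnm_muln (mnm1 l) m.-1).
Proof.
rewrite /fermat raddf_sum/= (bigD1 l)//= big1 ?addr0 => [|k kl].
  rewrite mderivX mulmnE mnm1E eqxx mul1n; congr (_ *: mpolyX _ _).
  apply/mnmP => j; rewrite mnmBE !mulmnE mnm1E.
  by case: (l == j); rewrite ?mul1n ?mul0n ?sub0n// subn1.
by rewrite mderivX mulmnE mnm1E (negbTE kl) mul0n scale0r.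
Qed.

Lemma dhomog_mderiv f l d : f \is ishomog1 d mdeg ->
  mderiv l f \is ishomog1 d.-1 mdeg.
Proof.
move=> /dhomogP fd; apply/dhomogP => u; rewrite mcoeff_msupp mcoeff_mderiv.
move=> u0; have ul : mnm_add u (mnm1 l) \in msupp f.
  by rewrite mcoeff_msupp; apply: contraNneq u0 => ->; rewrite mul0rn.
have <- : mdeg (mnm_add u (mnm1 l)) = d by exact: fd.
by rewrite mdegD mdeg1 addn1.
Qed.

Let D := (n.+1 * m.-1).+1.
Let I : finType := bmultinom n.+1 D.+1.

(** Pigeonhole: [D] exceeds by one the largest degree of a monomial all of whose
    exponents are below [m - 1]. Hence every monomial of degree [D] is a
    multiple of a partial derivative of the Fermat form. *)
Lemma big_exponent (u : multinom n.+1) : mdeg u = D ->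
  exists l, (m.-1 <= u l)%N.
Proof.
move=> uD; apply: contrapT => /forallNP small.
have : (mdeg u <= n.+1 * m.-1)%N.
  rewrite mdegE -[X in (_ <= X * _)%N]card_ord -sum_nat_const.
  by apply: leq_sum => l _; rewrite ltnW// ltnNge; apply/negP/small.
by rewrite uD ltnn.
Qed.

Definition exponent_index (u : multinom n.+1) : 'I_n.+1 :=
  odflt ord0 [pick l | (m.-1 <= u l)%N].

Lemma exponent_indexP (u : multinom n.+1) : mdeg u = D ->
  (m.-1 <= u (exponent_index u))%N.
Proof.
move=> /big_exponent[l ul]; rewrite /exponent_index.
by case: pickP => [//|/(_ l)]; rewrite ul.
Qed.

Definition monomial_value z (u : multinom n.+1) : K :=
  if mdeg u == D then \prod_l z l ^+ u l else 0.

Definition cofactor_monomial (u : multinom n.+1) : multinom n.+1 :=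
  mnm_sub u (mnm_muln (mnm1 (exponent_index u)) m.-1).

(** A multiple of a partial derivative of [f] of the same degree as [u]; at a
    singular point of [f + c * fermat], it equals a constant times the monomial
    [u]. *)
Definition reduction f (u : multinom n.+1) : mpoly n.+1 K :=
  mderiv (exponent_index u) f * mpolyX K (cofactor_monomial u).

Lemma cofactor_monomialK (u : multinom n.+1) : mdeg u = D ->
  mnm_add (mnm_muln (mnm1 (exponent_index u)) m.-1) (cofactor_monomial u) = u.
Proof.
move=> /exponent_indexP ul; apply/mnmP => j.
rewrite mnmDE mnmBE subnKC// mulmnE mnm1E.
by case: eqP => [<-|_]; rewrite ?mul1n ?mul0n.
Qed.

Lemma dhomog_reduction f (u : multinom n.+1) : f \is ishomog1 m mdeg ->
  mdeg u = D -> reduction f u \is ishomog1 D mdeg.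
Proof.
move=> fm uD; have <- : (m.-1 + mdeg (cofactor_monomial u))%N = D.
  by rewrite -uD -[in RHS](cofactor_monomialK uD) mdegD mdegMn mdeg1 mul1n.
by apply: dhomogM; [apply: dhomog_mderiv|rewrite dhomogX].
Qed.

Lemma meval_dhomog z f : f \is ishomog1 D mdeg ->
  meval z f = \sum_(u : I) mcoeff u f * monomial_value z u.
Proof.
move=> fD.
have fs : (@mmeasure _ _ mdeg f <= D.+1)%N.
  rewrite mmeasureE big_seq; elim/big_ind: _ => // [a b aD bD|u uf].
    by rewrite geq_max aD.
  by rewrite (dhomogP _ _ _ fD _ uf).
rewrite {1}(mpolywE fs) raddf_sum/=; apply: eq_bigr => u _.
rewrite mevalZ mevalX /monomial_value; case: eqP => // /eqP uD.
by rewrite (dhomog_nemf_coeff fD)// !mul0r.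
Qed.

(** At a singular point [z] the partial derivative of [f] is [- c] times that of
    the Fermat form. Multiplied by the cofactor of [u], this says that the
    vector of all monomials of degree [D] at [z] is an eigenvector, for the
    eigenvalue [- c * m], of a matrix that depends on [f] alone. *)
Lemma singular_eigenvector f c z u : f \is ishomog1 m mdeg ->
    (forall l, meval z (mderiv l (f + c *: fermat K)) = 0) -> mdeg u = D ->
  meval z (reduction f u) = - (c * m%:R) * monomial_value z u.
Proof.
move=> fm sing uD; rewrite /reduction mevalM.
have /eqP := sing (exponent_index u).
rewrite mderivD mderivZ mderiv_fermat mevalD !mevalZ addr_eq0 => /eqP ->.
rewrite !mulNr -!mulrA; congr (- (_ * (_ * _))).
by rewrite -mevalM -mpolyXD cofactor_monomialK// mevalX /monomial_value uD eqxx.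
Qed.

(** A matrix has finitely many eigenvalues, and the vector of monomials of
    degree [D] at [z] is not zero because it contains the powers of the
    coordinates. *)
Lemma fermat_perturbation f : f \is ishomog1 m mdeg ->
  exists s : seq K, forall c, c \notin s ->
    forall z, (exists l, z l != 0) ->
      exists l, meval z (mderiv l (f + c *: fermat K)) != 0.
Proof.
move=> fm.
pose E (i : 'I_#|I|) : I := enum_val i.
pose A : 'M[K]_#|I| := \matrix_(j, i)
  (if mdeg (E i) == D then mcoeff (E j) (reduction f (E i)) else 0).
have [r char_r] := closed_field_poly_normal (char_poly A).
(* The excluded values of [c] are those for which [- c * m] is an eigenvalue. *)
exists (map (fun a => - (a / m%:R)) r) => c cr z [l zl].
apply: contrapT => /forallNP sing0.
have sing k : meval z (mderiv k (f + c *: fermat K)) = 0.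
  by apply/eqP/negPn/negP/sing0.
move/negP: cr; apply; apply/mapP; exists (- (c * m%:R)); last first.
  by rewrite mulNr opprK mulfK.
have : root (char_poly A) (- (c * m%:R)).
  rewrite -eigenvalue_root_char; apply/eigenvalueP.
  exists (\row_j monomial_value z (E j)).
    apply/rowP => i; rewrite !mxE.
    under eq_bigr do rewrite !mxE.
    have [uD|uD] := eqVneq (mdeg (E i)) D; last first.
      rewrite big1 => [|j _]; last by rewrite mulr0.
      by rewrite /monomial_value (negbTE uD) mulr0.
    rewrite -(singular_eigenvector fm sing uD).
    rewrite (meval_dhomog _ (dhomog_reduction fm uD)).
    rewrite [RHS](reindex E)/=; last exact/onW_bij/enum_val_bij.
    by apply: eq_bigr => j _; rewrite mulrC.
  have lD : (mdeg (mnm_muln (mnm1 l) D : multinom n.+1) < D.+1)%N.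
    by rewrite mdegMn mdeg1 mul1n.
  apply/eqP => /rowP /(_ (enum_rank (BMultinom lD : I))).
  rewrite !mxE /E enum_rankK /monomial_value/= mdegMn mdeg1 mul1n eqxx.
  rewrite (bigD1 l)//= big1 ?mulr1 => [|k kl].
    by rewrite mulmnE mnm1E eqxx mul1n => /eqP; rewrite expf_eq0 (negbTE zl) andbF.
  by rewrite mulmnE mnm1E eq_sym (negbTE kl) mul0n expr0.
rewrite char_r rootZ ?lead_coef_eq0 ?monic_neq0 ?char_poly_monic//.
by rewrite root_prod_XsubC.
Qed.

End FermatPerturbation.

Lemma avoid_small (R : realType) (T : eqType) (g : R -> T) (s : seq T) (e : R) :
  injective g -> 0 < e -> exists2 c, 0 < c <= e & g c \notin s.
Proof.
move=> ginj e0; pose h k := g (e / k.+1%:R).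
have hinj : injective h.
  move=> j k /ginj /(mulfI (lt0r_neq0 e0)) /invr_inj /eqP.
  by rewrite eqr_nat eqSS => /eqP.
have /hasP[_ /mapP[k _ ->] ks] : has [predC s] (map h (iota 0 (size s).+1)).
  rewrite has_predC; apply/negP => /allP /uniq_leq_size.
  rewrite map_inj_uniq// iota_uniq size_map size_iota => /(_ isT).
  by rewrite ltnn.
exists (e / k.+1%:R) => //.
rewrite divr_gt0 ?ltr0n//= ler_pdivrMr ?ltr0n//.
by apply: ler_peMr; [exact: ltW|rewrite ler1n].
Qed.

Lemma nonsingular_perturbation (R : realType) (n m : nat) (f : mpoly n.+1 R)
    (e : R) :
  (0 < m)%N -> f \is ishomog1 m mdeg -> 0 < e ->
  exists2 c, 0 < c <= e & nonsingular (f + c *: fermat n m R).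
Proof.
move=> m0 /dhomogP fm e0.
have mC : m%:R != 0 :> R[i] by rewrite pnatr_eq0 -lt0n.
have Cf : complexify f \is ishomog1 m mdeg.
  apply/dhomogP => u; rewrite mcoeff_msupp mcoeff_map_mpoly => u0; apply: fm.
  by rewrite mcoeff_msupp; apply: contraNneq u0 => ->.
have [s sP] := fermat_perturbation mC Cf.
have [c c0e cs] := avoid_small s (fmorph_inj (real_complex R)) e0.
exists c => // z /(sP _ cs) [l zl] _; exists l.
suff -> : complexify (f + c *: fermat n m R) =
  complexify f + real_complex R c *: fermat n m R[i] by [].
rewrite /complexify rmorphD/= map_mpolyZ; congr (_ + _ *: _).
by rewrite /fermat rmorph_sum/=; apply: eq_bigr => l' _; rewrite map_mpolyX.
Qed.

(** * Paths on a smooth real zero locus *)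

(** Induction on the construction of a polynomial from constants and variables,
    which suits properties that are stable by sums and products. *)
Lemma mpoly_algebra_ind (A : comNzRingType) (k : nat) (Q : mpoly k A -> Prop) :
  (forall a, Q (mpolyC k a)) -> (forall i, Q (mpolyX A (mnm1 i))) ->
  (forall p q, Q p -> Q q -> Q (p + q)) ->
  (forall p q, Q p -> Q q -> Q (p * q)) -> forall p, Q p.
Proof.
move=> QC QX QD QM p; rewrite [p]mpolyE.
elim/big_ind: _ => [|//|u _]; first by rewrite -mpolyC0.
rewrite -mul_mpolyC; apply: (QM) => //; rewrite mpolyXE_id.
elim/big_ind: _ => [|p1 q1|i _]; first by rewrite -mpolyC1.
  exact: QM.
by elim: (u i) => [|d IH]; rewrite ?expr0 -?mpolyC1// exprS; apply: (QM).
Qed.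

Section RealPolynomials.
Variables (R : realType) (n : nat).
Implicit Types (f : mpoly n.+1 R) (v w : 'rV[R]_n.+1).

Definition value f v : R := meval (v 0) f.

Lemma value_continuous f : continuous (value f).
Proof.
elim/mpoly_algebra_ind: f => [a|i|p q cp cq|p q cp cq] v.
- have -> : value (mpolyC n.+1 a) = fun=> a.
    by apply/funext => w; rewrite /value mevalC.
  exact: cst_continuous.
- have -> : value (mpolyX R (mnm1 i)) = fun w => w 0 i.
    by apply/funext => w; rewrite /value mevalXU.
  exact: coord_continuous.
- have -> : value (p + q) = value p \+ value q.
    by apply/funext => w; rewrite /value mevalD.
  exact: (continuousD (cp v) (cq v)).
- have -> : value (p * q) = value p \* value q.
    by apply/funext => w; rewrite /value mevalM.
  exact: (continuousM (cp v) (cq v)).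
Qed.

Definition axis (l : 'I_n.+1) : 'rV[R]_n.+1 := delta_mx 0 l.

(** Hadamard division along a coordinate axis. The continuity of the quotient,
    at [s = 0] included, replaces the differential calculus in the study of the
    zero locus near a smooth point. *)
Lemma value_difference f l : exists G : 'rV[R]_n.+1 * R -> R,
  [/\ continuous G, forall w s, value f (w + s *: axis l) = value f w + s * G (w, s)
    & forall w, G (w, 0) = value (mderiv l f) w].
Proof.
elim/mpoly_algebra_ind: f => [a|i|p q [G [cG dG G0]] [H [cH dH H0]]
    |p q [G [cG dG G0]] [H [cH dH H0]]].
- exists (fun=> 0); split=> [x|w s|w]; first exact: cvg_cst.
    by rewrite mulr0 addr0 /value !mevalC.
  by rewrite mderivC /value meval0.
- exists (fun=> (i == l)%:R); split=> [x|w s|w]; first exact: cvg_cst.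
    by rewrite /value !mevalXU !mxE eqxx.
  rewrite mderivX mnm1E /value mevalZ; case: eqP => [->|_]; last by rewrite mul0r.
  have -> : mnm_sub (mnm1 l : multinom n.+1) (mnm1 l) = mnm0.
    by apply/mnmP => j; rewrite mnmBE mnm0E subnn.
  by rewrite mul1r mpolyX0 meval1.
- exists (G \+ H); split=> [x|w s|w]/=.
  + by apply: cvgD; [apply: cG|apply: cH].
  + by rewrite /value !mevalD -!/(value _ _) dG dH; ring.
  + by rewrite G0 H0 mderivD /value mevalD.
- exists (fun x => G x * (value q x.1 + x.2 * H x) + value p x.1 * H x).
  split=> [x|w s|w]/=.
  + have cv g : {for x, continuous (fun y : 'rV[R]_n.+1 * R => value g y.1)}.
      by apply: continuous_comp; [exact: cvg_fst|exact: value_continuous].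
    apply: cvgD; last by apply: cvgM; [exact: cv|exact: cH].
    apply: cvgM; first exact: cG.
    by apply: cvgD; [exact: cv|apply: cvgM; [exact: cvg_snd|exact: cH]].
  + by rewrite /value !mevalM -!/(value _ _) dG dH; ring.
  + by rewrite G0 H0 mul0r addr0 mderivM /value mevalD !mevalM.
Qed.

End RealPolynomials.

(** Monotonicity gives the root at each time and its uniqueness; continuity of
    the root follows since strict signs at [g t - d] and [g t + d] persist for
    nearby times. *)
Lemma implicit_function (R : realType) (phi : R -> R -> R) (r : R) :
    0 < r ->
    (forall t, {in `[- r, r] &, {homo phi t : s s' / s < s'}}) ->
    (forall t, phi t (- r) < 0 < phi t r) ->
    (forall t, continuous (phi t)) -> (forall s, continuous (phi ^~ s)) ->
  exists2 g : R -> R, continuous g &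
    forall t, [/\ g t \in `[- r, r], phi t (g t) = 0
      & forall s, s \in `[- r, r] -> phi t s = 0 -> s = g t].
Proof.
move=> r0 incr sgn cs ct.
have root t : {s | s \in `[- r, r] & phi t s = 0}.
  apply/cid2; have /andP[lo hi] := sgn t.
  have rr : - r <= r by rewrite lerNl; lra.
  apply: IVT => //; first exact: continuous_subspaceT.
  by rewrite ge_min le_max (ltW lo) (ltW hi) orbT.
pose g t := projT1 (sig_of_sig2 (root t)).
have gr t : g t \in `[- r, r] by rewrite /g; case: (root t).
have g0 t : phi t (g t) = 0 by rewrite /g; case: (root t).
have inc t s s' : s \in `[- r, r] -> s' \in `[- r, r] ->
    (phi t s < phi t s') = (s < s').
  move=> sr s'r; apply/idP/idP => [|ss']; last exact: incr.
  apply: contraTT; rewrite -!leNgt le_eqVlt => /orP[/eqP->//|s's].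
  exact/ltW/incr.
exists g => [t|t]; last first.
  split=> // s sr s0; apply/eqP; rewrite eq_le !leNgt.
  by rewrite -(inc t (g t))// -(inc t s)// s0 g0 ltxx.
have glt t' : - r < g t' < r.
  have /andP[lo hi] := sgn t'.
  by rewrite -(inc t' (- r))// -?(inc t' _ r)// ?g0 ?lo ?hi// in_itv/=; lra.
apply/cvgrPdist_lt => e e0.
have /andP[glo ghi] := glt t.
pose d := Num.min e (Num.min (g t + r) (r - g t)).
have d0 : 0 < d by rewrite !lt_min e0; lra.
have [de d1 d2] : [/\ d <= e, d <= g t + r & d <= r - g t].
  by split; rewrite !ge_min lexx ?orbT.
have dlo : g t - d \in `[- r, r] by rewrite in_itv/=; lra.
have dhi : g t + d \in `[- r, r] by rewrite in_itv/=; lra.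
have lo : phi t (g t - d) < 0 by rewrite -(g0 t) inc//; lra.
have hi : 0 < phi t (g t + d) by rewrite -(g0 t) inc//; lra.
near=> t'.
have lo' : phi t' (g t - d) < 0.
  by near: t'; apply: (cvgr_lt _ (ct (g t - d) t)).
have hi' : 0 < phi t' (g t + d).
  by near: t'; apply: (cvgr_gt _ (ct (g t + d) t)).
move: lo' hi'; rewrite -(g0 t') !inc ?gr// => lo' hi'.
by rewrite ltr_norml; lra.
Unshelve. all: by end_near. Qed.

Section LocalPaths.
Variables (R : realType) (n : nat).
Implicit Types (f : mpoly n.+1 R) (v w : 'rV[R]_n.+1).

(** Retraction onto the unit interval, so that paths can be defined and stay in
    the zero locus for all real times. *)
Definition clamp (t : R) : R := Num.min (Num.max t 0) 1.

Lemma clamp_itv t : 0 <= clamp t <= 1.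
Proof. by rewrite /clamp le_min le_max lexx orbT ler01 ge_min lexx orbT. Qed.

Lemma clamp_id t : 0 <= t <= 1 -> clamp t = t.
Proof. by move=> /andP[t0 t1]; rewrite /clamp max_l// min_l. Qed.

Lemma clamp_continuous : continuous clamp.
Proof.
move=> t.
apply: (@continuous_min R R (fun u => Num.max u 0) (fun=> 1)).
  by apply: (@continuous_max R R id (fun=> 0)); [exact: cvg_id|exact: cst_continuous].
exact: cst_continuous.
Qed.

Definition zero_path f (v w : 'rV[R]_n.+1) : Prop :=
  exists gamma : R -> 'rV[R]_n.+1,
    [/\ continuous gamma, gamma 0 = v, gamma 1 = w
      & forall t, gamma t != 0 /\ value f (gamma t) = 0].

(** Along the axis [l] the form is strictly increasing near [v]. Follow the
    straight segment from [v] to [w] and correct it by the unique displacement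
    along the axis that brings it back to the zero locus: the displacement is
    continuous, and it vanishes at both ends because these are zeros already. *)
Lemma local_zero_path_pos f v l : value f v = 0 -> v != 0 ->
  0 < value (mderiv l f) v ->
  \forall w \near v, value f w = 0 -> zero_path f v w.
Proof.
move=> fv v0; have [G [cG dG G0]] := value_difference f l.
rewrite -G0 => /(cvgr_gt _ (cG (v, 0))) /nbhs_ballP[rho /= rho0 Gpos].
have {}Gpos w s : `|w - v| < rho -> `|s| < rho -> 0 < G (w, s).
  move=> wv s0; apply: Gpos; split; rewrite -ball_normE/=.
    by rewrite distrC.
  by rewrite sub0r normrN.
set e := axis R l in dG.
(* Within [q] of [v] for the segment and again [q] for the displacement along
   the axis, the quotient stays positive and the vector nonzero. *)
pose q := Num.min rho `|v| / 4.
have q0 : 0 < q by rewrite divr_gt0// lt_min rho0 normr_gt0.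
have [qrho qv] : q * 4 <= rho /\ q * 4 <= `|v|.
  by rewrite /q divfK// !ge_min !lexx orbT.
have e0 : 0 <= `|e| by [].
pose r := q / (1 + `|e|).
have r0 : 0 < r by rewrite divr_gt0//; lra.
have rq : r * `|e| + r = q by rewrite -[X in _ + X = _]mulr1 -mulrDr addrC /r divfK//; lra.
have rq' : r * `|e| <= q /\ r <= q.
  by have : 0 <= r * `|e| by [rewrite mulr_ge0// ltW]; lra.
have se s : `|s| <= r -> `|s *: e| <= q.
  by move=> sr; rewrite normrZ (le_trans _ rq'.1)// ler_wpM2r.
have inc w s s' : `|w - v| <= q -> s \in `[- r, r] -> s' \in `[- r, r] ->
    s < s' -> value f (w + s *: e) < value f (w + s' *: e).
  rewrite !in_itv/= => wv sr s'r ss'.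
  have -> : w + s' *: e = (w + s *: e) + (s' - s) *: e.
    by rewrite -addrA -scalerDl [s + _]addrC subrK.
  rewrite [ltRHS]dG ltrDl mulr_gt0 ?subr_gt0//; apply: Gpos.
    rewrite addrAC; apply: le_lt_trans (ler_normD _ _) _.
    by have := se s; rewrite ler_norml sr => /(_ isT); lra.
  by rewrite ltr_norml; lra.
have r_in : [/\ - r \in `[- r, r], 0 \in `[- r, r] & r \in `[- r, r]].
  by split; rewrite in_itv/=; lra.
case: r_in => rl rm rr.
have vv : `|v - v| <= q by rewrite subrr normr0 ltW.
have lo : value f (v + (- r) *: e) < 0.
  by rewrite -fv -[X in _ < value f X]addr0 -(scale0r e) inc//; lra.
have hi : 0 < value f (v + r *: e).
  by rewrite -fv -[X in value f X < _]addr0 -(scale0r e) inc//; lra.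
have cshift s : continuous (fun w => value f (w + s *: e)).
  move=> w; apply: continuous_comp; last exact: value_continuous.
  by apply: continuousD; [exact: cvg_id|exact: cst_continuous].
have /nbhs_ballP[d1 /= d10 lo1] : \forall w \near v, value f (w + (- r) *: e) < 0.
  exact: (cvgr_lt _ (cshift (- r) v)).
have /nbhs_ballP[d2 /= d20 hi1] : \forall w \near v, 0 < value f (w + r *: e).
  exact: (cvgr_gt _ (cshift r v)).
pose d := Num.min q (Num.min d1 d2).
have d0 : 0 < d by rewrite !lt_min q0 d10.
apply/nbhs_ballP; exists d => //= w; rewrite -ball_normE/= distrC => wd fw.
pose x t := v + clamp t *: (w - v).
have xv t : `|x t - v| < d.
  rewrite /x addrAC subrr add0r normrZ (le_lt_trans _ wd)//.
  have /andP[c0 c1] := clamp_itv t.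
  by rewrite ger0_norm// ler_piMl.
have dle : [/\ d <= q, d <= d1 & d <= d2] by split; rewrite !ge_min lexx ?orbT.
have cx : continuous x.
  move=> t; rewrite /x; apply: cvgD; first exact: cvg_cst.
  by apply: cvgZ; [exact: clamp_continuous|exact: cvg_cst].
have [g cg gP] : exists2 g : R -> R, continuous g & forall t,
    [/\ g t \in `[- r, r], value f (x t + g t *: e) = 0
      & forall s, s \in `[- r, r] -> value f (x t + s *: e) = 0 -> s = g t].
  apply: implicit_function => //.
  - move=> t s s' sr s'r; apply: inc => //.
    by have := xv t; case: dle; lra.
  - move=> t; have := xv t; case: dle => dq dd1 dd2 xd; apply/andP; split.
      apply: lo1; rewrite -ball_normE/= distrC; lra.
    by apply: hi1; rewrite -ball_normE/= distrC; lra.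
  - move=> t s; apply: continuous_comp; last exact: value_continuous.
    apply: cvgD; first exact: cvg_cst.
    by apply: cvgZ; [exact: cvg_id|exact: cvg_cst].
  - move=> s t; apply: continuous_comp; last exact: value_continuous.
    by apply: cvgD; [exact: cx|exact: cvg_cst].
have x0 : x 0 = v by rewrite /x clamp_id ?lexx ?ler01// scale0r addr0.
have x1 : x 1 = w.
  by rewrite /x clamp_id ?lexx ?ler01// scale1r addrC subrK.
have g0 : g 0 = 0.
  by have [_ _ gu] := gP 0; apply/esym/gu => //; rewrite scale0r addr0 x0.
have g1 : g 1 = 0.
  by have [_ _ gu] := gP 1; apply/esym/gu => //; rewrite scale0r addr0 x1.
exists (fun t => x t + g t *: e); split.
- move=> t; apply: cvgD; first exact: cx.
  by apply: cvgZ; [exact: cg|exact: cvg_cst].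
- by rewrite g0 scale0r addr0.
- by rewrite g1 scale0r addr0.
- move=> t; have [gr gz _] := gP t; split=> //.
  have ge : `|g t *: e| <= q by apply: se; move: gr; rewrite in_itv/= ler_norml.
  apply: contraTneq v0 => xg; rewrite negbK -normr_eq0.
  have : `|v| <= `|x t - v| + `|g t *: e|.
    rewrite -normrN (le_trans _ (ler_normD _ _))//.
    by rewrite addrAC xg sub0r.
  have : 0 <= `|v| by [].
  by have := xv t; case: dle; lra.
Qed.

Lemma local_zero_path f v l : value f v = 0 -> v != 0 ->
  value (mderiv l f) v != 0 ->
  \forall w \near v, value f w = 0 -> zero_path f v w.
Proof.
move=> fv v0; rewrite neq_lt orbC => /orP[|dneg]; first exact: local_zero_path_pos.
have valueN g w : value (- g) w = - value g w by rewrite /value mevalN.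
have : \forall w \near v, value (- f) w = 0 -> zero_path (- f) v w.
  apply: (@local_zero_path_pos _ _ l) => //; first by rewrite valueN fv oppr0.
  by rewrite mderivN valueN oppr_gt0.
apply: filterS => w fw fw0.
have [|g [cg g0 g1 gP]] := fw; first by rewrite valueN fw0 oppr0.
exists g; split=> // t; have [gt0 /eqP] := gP t.
by rewrite valueN oppr_eq0 => /eqP.
Qed.

End LocalPaths.

(** * Homology classes of points of the real part *)

Lemma value_scale (R : realType) (n m : nat) (f : mpoly n.+1 R) c v :
  f \is ishomog1 m mdeg -> value f (c *: v) = c ^+ m * value f v.
Proof.
move=> /dhomogP fm; rewrite /value !mevalE mulr_sumr.
rewrite big_seq [RHS]big_seq; apply: eq_bigr => u uf.
have <- : mdeg u = m by exact: fm.
rewrite mulrCA; congr (_ * _); rewrite mdegE -prodrXr -big_split/=.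
by apply: eq_bigr => i _; rewrite mxE exprMn.
Qed.

Section RealPart.
Variables (R : realType) (n m : nat) (f : mpoly n.+1 R).
Local Notation vec := 'rV[R]_n.+1.
Local Notation X := (real_part f : topologicalType).
Local Notation simplex k := (continuousType (@std_simplex R k) X).

(** The points of the real part are handled through vectors that represent them:
    paths of vectors are easier to build than paths in a quotient. *)
Definition zero_vector (v : vec) : Prop := v != 0 /\ value f v = 0.

Definition nonzero (v : vec) (Hv : zero_vector v) : @nonzero_vector R n :=
  SigSub (mem_set (Hv.1 : @nonzero_vector R n v)).

Lemma zero_class (v : vec) (Hv : zero_vector v) :
  real_part f (\pi_(RP R n)%qT (nonzero Hv)).
Proof. by exists (nonzero Hv) => //; exact: Hv.2. Qed.

Definition zero_point (v : vec) (Hv : zero_vector v) : X :=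
  SigSub (mem_set (zero_class Hv)).

Definition zero_simplex (v : vec) (Hv : zero_vector v) : simplex 0 :=
  cst (zero_point Hv).

Lemma std_simplex0_val (t : @std_simplex R 0) : set_val t 0 0 = 1.
Proof. by have [_ <-] := set_valP t; rewrite big_ord1. Qed.

Lemma const_mx1_simplex : @std_simplex R 0 (const_mx 1).
Proof. by split=> [l|]; rewrite ?big_ord1 mxE ?ler01. Qed.

Definition vertex : @std_simplex R 0 := SigSub (mem_set const_mx1_simplex).

Lemma vertexP t : t = vertex.
Proof.
apply: val_inj; apply/rowP => i; rewrite !ord1 mxE.
exact: std_simplex0_val.
Qed.

Section Path.
Variables (gamma : R -> vec) (zgamma : forall t, zero_vector (gamma t)).
Hypothesis cgamma : continuous gamma.

Definition path_map (s : @std_simplex R 1) : X :=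
  zero_point (zgamma (set_val s 0 ord_max)).

Lemma path_map_continuous : continuous path_map.
Proof.
apply: continuous_comp_initial => s.
pose nv (s : @std_simplex R 1) := nonzero (zgamma (set_val s 0 ord_max)).
have -> : set_val \o path_map = \pi_(RP R n)%qT \o nv by [].
apply: continuous_comp; last exact: pi_continuous.
move: s; apply: continuous_comp_initial => s.
have -> : set_val \o nv = gamma \o (fun w : 'rV[R]_2 => w 0 ord_max) \o set_val.
  by [].
apply: continuous_comp; first exact: initial_continuous.
by apply: continuous_comp; [exact: coord_continuous|exact: cgamma].
Qed.

HB.instance Definition _ := isContinuous.Build _ _ path_map path_map_continuous.

(** The singular 1-simplex of the real part that a path of zero vectors induces,
    its parameter being the last barycentric coordinate. *)
Definition path_simplex : simplex 1 := path_map.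

End Path.

Lemma zero_point_eq (v w : vec) (Hv : zero_vector v) (Hw : zero_vector w) :
  v = w -> zero_point Hv = zero_point Hw.
Proof. by move=> vw; case: _ / vw in Hw *; rewrite (Prop_irrelevance Hv Hw). Qed.

Lemma linked_zero_path (v w : vec) (Hv : zero_vector v) (Hw : zero_vector w) :
  zero_path f v w -> linked (zero_simplex Hw) (zero_simplex Hv).
Proof.
move=> [g [cg g0 g1 gz]].
have -> : zero_simplex Hv = endpoint ord_max (path_simplex gz cg).
  apply/continuousEP => t; apply: zero_point_eq; rewrite -g0; congr g.
  by rewrite /= mxE unlift_none.
have -> : zero_simplex Hw = endpoint ord0 (path_simplex gz cg).
  apply/continuousEP => t; apply: zero_point_eq; rewrite -g1; congr g.
  rewrite /= mxE (_ : ord_max = fintype.lift ord0 ord0); last exact: val_inj.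
  by rewrite liftK std_simplex0_val.
exact: linked_ends.
Qed.

(** Vectors of norm 1 represent all points, which brings compactness into play. *)
Lemma simplex0_zero (s : simplex 0) : f \is ishomog1 m mdeg ->
  exists v (Hv : zero_vector v), `|v| = 1 /\ s = zero_simplex Hv.
Proof.
move=> fm.
have [v fv vs] := set_valP (s vertex).
have v0 : set_val v != 0 := set_valP v.
pose c : R := `|set_val v|^-1.
have c0 : c != 0 by rewrite invr_eq0 normr_eq0.
have cv : zero_vector (c *: set_val v).
  by split; [rewrite scaler_eq0 negb_or c0|rewrite (value_scale _ _ fm) [value _ _]fv mulr0].
exists (c *: set_val v), cv; split.
  by rewrite normrZ /c ger0_norm ?invr_ge0// mulVf ?normr_eq0.
apply/continuousEP => t; rewrite (vertexP t); apply: val_inj; rewrite -[LHS]vs /=; apply/eqmodP/asboolP.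
exists c^-1; first by rewrite invr_eq0.
by rewrite scalerA mulVf// scale1r.
Qed.

(** Nonsingularity is a condition on complex points; it is applied to a real
    one, at which complexification commutes with evaluation and with derivation. *)
Lemma gradient_neq0 (v : vec) : nonsingular f -> zero_vector v ->
  exists l, value (mderiv l f) v != 0.
Proof.
move=> fns [v0 fv].
have cD (p q : mpoly n.+1 R) : complexify (p + q) = complexify p + complexify q.
  exact: rmorphD.
have cM (p q : mpoly n.+1 R) : complexify (p * q) = complexify p * complexify q.
  exact: rmorphM.
have Cvalue (g : mpoly n.+1 R) :
    meval (fun l => real_complex R (v 0 l)) (complexify g) =
    real_complex R (value g v).
  elim/mpoly_algebra_ind: g => [a|i|p q IHp IHq|p q IHp IHq].
  - by rewrite /complexify map_mpolyC /value !mevalC.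
  - by rewrite /complexify map_mpolyX /value !mevalXU.
  - rewrite cD mevalD; apply: eq_trans (congr2 +%R IHp IHq) _.
    rewrite /value mevalD.
    exact/esym/(rmorphD (real_complex R)).
  - rewrite cM mevalM; apply: eq_trans (congr2 *%R IHp IHq) _.
    rewrite /value mevalM.
    exact/esym/(rmorphM (real_complex R)).
have [|/=|l dl] := fns (fun l => real_complex R (v 0 l)).
- have /rV0Pn[l vl] := v0; exists l.
  by rewrite fmorph_eq0.
- by rewrite Cvalue fv.
- exists l; apply: contraNneq dl => dl0.
  suff <- : complexify (mderiv l f) = mderiv l (complexify f).
    by rewrite Cvalue dl0.
  apply/mpolyP => u; rewrite mcoeff_mderiv !mcoeff_map_mpoly mcoeff_mderiv.
  exact: rmorphMn.
Qed.

(** The zeros of norm 1 form a compact set, each point of which has a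
    neighbourhood of zeros that a path joins to it; finitely many such
    neighbourhoods cover. *)
Lemma finite_classes : f \is ishomog1 m mdeg -> nonsingular f ->
  exists es : seq (simplex 0), forall s, exists2 e, e \in es & linked s e.
Proof.
move=> fm fns.
pose K : set vec := [set v | `|v| = 1 /\ value f v = 0].
have Kzero v : K v -> zero_vector v.
  move=> [v1 fv]; split=> //; apply/eqP => v0.
  by move/eqP: v1; rewrite v0 normr0 eq_sym oner_eq0.
have cptK : compact K.
  apply: bounded_closed_compact.
    exists 1; split=> // M M1 v [v1 _]; apply: le_trans (ltW M1).
    by have := lexx (1 : R); rewrite -{1}v1.
  have -> : K = (fun v => `|v|) @^-1` [set 1] `&` value f @^-1` [set 0] by [].
  apply: closedI; apply: preimage_closed => //.
  - by move=> v _; exact: norm_continuous.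
  - by move=> v _; exact: value_continuous.
pose U (e : simplex 0) : set vec :=
  interior [set w | forall Hw : zero_vector w, linked (zero_simplex Hw) e].
have : cover_compact K by rewrite -compact_cover.
move=> /(_ _ setT U) [e _||D _ KD].
- exact: open_interior.
- move=> v Kv; exists (zero_simplex (Kzero v Kv)) => //.
  have [v0 fv] := Kzero v Kv.
  have [l dl] := gradient_neq0 fns (Kzero v Kv).
  rewrite /U/=; apply: filterS (local_zero_path fv v0 dl) => w fw Hw.
  exact: linked_zero_path (fw Hw.2).
exists (finmap.enum_fset D) => s.
have [v [Hv [v1 ->]]] := simplex0_zero s fm.
have [e De /interior_subset ve] := KD v (conj v1 Hv.2).
by exists e => //; exact: ve.
Qed.

End RealPart.

(** * Points separated by boxes *)

Section Separation.
Variables (R : realType) (n m : nat) (f : mpoly n.+1 R).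
Local Notation vec := 'rV[R]_n.+1.
Local Notation X := (real_part f : topologicalType).
Local Notation simplex k := (continuousType (@std_simplex R k) X).

Definition representative (x : X) : vec := set_val (repr (set_val x)).

(** Openness in the quotient is openness of the cone of representatives, and the
    chosen representatives decide membership because the cone is stable by
    scaling. *)
Lemma open_cone (U : set vec) : open U ->
  (forall a v, a != 0 -> U v -> U (a *: v)) ->
  open [set x : X | U (representative x)].
Proof.
move=> oU Uscale.
have oW : open [set y : RP R n | U (set_val (repr y))].
  rewrite /open/= /quotient_open.
  have -> : \pi_(RP R n)%qT @^-1` [set y : RP R n | U (set_val (repr y))] =
      set_val @^-1` U.
    apply/seteqP; split=> v /=.
      have /asboolP[a a0 ->] : proportional v (repr (\pi_(RP R n)%qT v)).
        by apply/eqmodP; rewrite reprK.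
      exact: Uscale.
    have /asboolP[a a0 ->] : proportional (repr (\pi_(RP R n)%qT v)) v.
      by apply/eqmodP; rewrite reprK.
    exact: Uscale.
  by apply: open_comp => // v _; exact: initial_continuous.
have -> : [set x : X | U (representative x)] =
  set_val @^-1` [set y : RP R n | U (set_val (repr y))] by [].
by apply: open_comp => // x _; exact: initial_continuous.
Qed.

Definition segment_row (u : R) : 'rV[R]_2 :=
  (1 - clamp u) *: delta_mx 0 0 + clamp u *: delta_mx 0 ord_max.

Lemma segment_rowE u : segment_row u 0 0 = 1 - clamp u /\
  segment_row u 0 ord_max = clamp u.
Proof. by rewrite !mxE !eqxx/= !mulr1 !mulr0 addr0 add0r. Qed.

Lemma segment_rowP u : @std_simplex R 1 (segment_row u).
Proof.
have /andP[c0 c1] := clamp_itv u.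
have [e0 e1] := segment_rowE u; split=> [l|].
  have [->|->] : l = 0 \/ l = ord_max.
    by case: l => -[|[|//]] ?; [left|right]; exact: val_inj.
    by rewrite e0 subr_ge0.
  by rewrite e1.
rewrite big_ord_recl big_ord1 e0 (_ : fintype.lift _ _ = ord_max) ?e1 ?subrK//.
exact: val_inj.
Qed.

Definition segment (u : R) : @std_simplex R 1 :=
  SigSub (mem_set (segment_rowP u)).

Lemma segment_continuous : continuous segment.
Proof.
apply: continuous_comp_initial => u.
have -> : set_val \o segment = segment_row by [].
apply: cvgD; (apply: cvgZ; last exact: cvg_cst).
  by apply: cvgB; [exact: cvg_cst|exact: clamp_continuous].
exact: clamp_continuous.
Qed.

Lemma segment_end (u : R) (j : 'I_2) : u = (j == 0)%:R ->
  segment u = face j (vertex R).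
Proof.
move=> uj; apply: val_inj; apply/rowP => l /=.
have cu : clamp u = u.
  by apply: clamp_id; rewrite uj; case: (j == 0); rewrite lexx ler01.
have [e0 e1] := segment_rowE u.
have ord2 (i : 'I_2) : i = 0 \/ i = ord_max.
  by case: i => -[|[|//]] ?; [left|right]; exact: val_inj.
rewrite [RHS]mxE; case: unliftP => [i ->|->]; last first.
  case: (ord2 j) uj => -> /= uE; first by rewrite e0 cu uE subrr.
  by rewrite e1 cu uE.
have -> : set_val (vertex R) 0 i = 1 by rewrite (ord1 i) std_simplex0_val.
rewrite (ord1 i); case: (ord2 j) uj => -> /= uE.
  rewrite (_ : fintype.lift _ _ = ord_max); last exact: val_inj.
  by rewrite e1 cu uE.
rewrite (_ : fintype.lift _ _ = 0); last exact: val_inj.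
by rewrite e0 cu uE subr0.
Qed.

(** A clopen set pulls back along a path to a clopen subset of the line, which
    is connected; no path leaves it. *)
Lemma clopen_end_invariant (A : set X) : open A -> open (~` A) ->
  end_invariant (fun s : simplex 0 => `[< A (s (vertex R)) >]).
Proof.
move=> oA oA' s.
have cs : continuous (s \o segment).
  move=> u; apply: continuous_comp; first exact: segment_continuous.
  exact: cts_fun.
pose B := (s \o segment) @^-1` A.
have oB : open B by apply: open_comp => // u _; exact: cs.
have cB : closed B.
  by apply: preimage_closed; [move=> u _; exact: cs|rewrite -openC].
have B01 : B 0 <-> B 1.
  have cR : connected [set: R] by apply/connected_intervalP.
  have BT u : B u -> B = setT.
    move=> Bu; apply: cR; first by exists u.
      by exists B; rewrite ?setTI.
    by exists B; rewrite ?setTI.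
  by split=> /BT ->.
rewrite /endpoint/= -!(segment_end (erefl _))/=.
by apply/asboolP/asboolP; apply B01.
Qed.

Definition chart_point (p : 'rV[R]_n) : vec :=
  \row_l (if unlift ord0 l is Some k then p 0 k else 1).

Definition in_box (lo hi : 'I_n -> R) (p : 'rV[R]_n) : Prop :=
  forall k, lo k <= p 0 k <= hi k.

Definition in_open_box (lo hi : 'I_n -> R) (p : 'rV[R]_n) : Prop :=
  forall k, lo k < p 0 k < hi k.

Definition isolating_box (lo hi : 'I_n -> R) : Prop :=
  (forall p, in_box lo hi p -> value f (chart_point p) = 0 ->
     in_open_box lo hi p) /\
  exists p q, [/\ in_box lo hi p, in_box lo hi q,
    value f (chart_point p) < 0 & 0 < value f (chart_point q)].

Lemma chart_point_continuous : continuous chart_point.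
Proof.
move=> p A [P tP sPA].
exists (fun i k => P i (fintype.lift ord0 k)).
  by move=> i k; have := tP i (fintype.lift ord0 k); rewrite mxE liftK (ord1 i).
move=> q qP; apply: sPA => i l; rewrite mxE.
have := tP i l; rewrite mxE; case: unliftP => [k ->|_] Pl.
  by have := qP i k; rewrite (ord1 i).
exact: nbhs_singleton Pl.
Qed.

(** The intermediate value theorem on the segment between the points of opposite
    signs; boxes are convex. *)
Lemma box_zero lo hi : isolating_box lo hi ->
  exists2 p, in_open_box lo hi p & value f (chart_point p) = 0.
Proof.
move=> [isol [p [q [pB qB fp fq]]]].
pose x (u : R) := p + u *: (q - p).
have xB u : 0 <= u <= 1 -> in_box lo hi (x u).
  move=> /andP[u0 u1] k; rewrite !mxE.
  have /andP[p1 p2] := pB k; have /andP[q1 q2] := qB k.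
  by apply/andP; split; nra.
have cx : continuous (fun u => value f (chart_point (x u))).
  move=> u; apply: continuous_comp; last exact: value_continuous.
  apply: continuous_comp; last exact: chart_point_continuous.
  rewrite /x; apply: cvgD; first exact: cvg_cst.
  by apply: cvgZ; [exact: cvg_id|exact: cvg_cst].
have [u u01 fu] : exists2 u, u \in `[0, 1]%R & value f (chart_point (x u)) = 0.
  apply: IVT; [exact: ler01|exact: continuous_subspaceT|].
  rewrite /x scale0r addr0 scale1r addrC subrK.
  by rewrite ge_min le_max (ltW fp) (ltW fq) orbT.
by exists (x u) => //; apply: isol => //; apply: xB; rewrite in_itv in u01.
Qed.

(** The cone of vectors over the points of a box of the chart, written without
    division. In the closed version below, a vector with vanishing first
    coordinate is zero because the box is bounded. *)
Definition open_cone_over (lo hi : 'I_n -> R) (v : vec) : Prop :=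
  0 < v 0 ord0 /\ forall k, lo k * v 0 ord0 < v 0 (fintype.lift ord0 k) < hi k * v 0 ord0.

Definition closed_cone_over (lo hi : 'I_n -> R) (v : vec) : Prop :=
  0 <= v 0 ord0 /\ forall k, lo k * v 0 ord0 <= v 0 (fintype.lift ord0 k) <= hi k * v 0 ord0.

Lemma coord_expr_continuous (a : R) (l : 'I_n.+1) :
  continuous (fun v : vec => v 0 l - a * v 0 ord0).
Proof.
move=> v; have cl i : (w : vec) 0 i @[w --> v] --> v 0 i.
  exact: coord_continuous.
exact: cvgB (cl l) (cvgM (cvg_cst a) (cl ord0)).
Qed.

Lemma open_open_cone_over lo hi : open (open_cone_over lo hi).
Proof.
rewrite openE => v [v0 vk].
have pos : \forall w \near v, 0 < (w : vec) 0 ord0.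
  have cv : (w : vec) 0 ord0 @[w --> v] --> v 0 ord0 by exact: coord_continuous.
  exact: (cvgr_gt _ cv).
suff box : \forall w \near v,
    forall k, lo k * (w : vec) 0 ord0 < w 0 (fintype.lift ord0 k) < hi k * w 0 ord0.
  by apply: filterS2 pos box => w.
apply: (@filter_forall _ _ _ _ (nbhs_filter v)) => k; have := vk k.
rewrite -subr_gt0 -[X in _ && X]subr_lt0 => /andP[lok hik].
have above : \forall w \near v,
    0 < (w : vec) 0 (fintype.lift ord0 k) - lo k * w 0 ord0.
  exact: (cvgr_gt _ (@coord_expr_continuous (lo k) _ v)).
have below : \forall w \near v,
    (w : vec) 0 (fintype.lift ord0 k) - hi k * w 0 ord0 < 0.
  exact: (cvgr_lt _ (@coord_expr_continuous (hi k) _ v)).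
apply: filterS2 above below => w.
by rewrite subr_gt0 subr_lt0 => -> ->.
Qed.

Lemma closed_closed_cone_over lo hi : closed (closed_cone_over lo hi).
Proof.
have -> : closed_cone_over lo hi = [set v | 0 <= v 0 ord0] `&`
  \bigcap_(k in [set: 'I_n])
    ([set v | 0 <= v 0 (fintype.lift ord0 k) - lo k * v 0 ord0]
    `&` [set v | v 0 (fintype.lift ord0 k) - hi k * v 0 ord0 <= 0]).
  apply/seteqP; split=> v /= [v0 vk]; split=> // k; last first.
    by apply/andP; have [] := vk k I; rewrite /= subr_ge0 subr_le0.
  by move=> _; have /andP[] := vk k; rewrite /= subr_ge0 subr_le0.
apply: closedI.
  apply: (@preimage_closed _ _ (fun v : vec => v 0 ord0) [set x : R | 0 <= x]).
    by move=> v _; exact: coord_continuous.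
  exact: closed_ge.
apply: closed_bigI => k _; apply: closedI.
  apply: (@preimage_closed _ _
    (fun v : vec => v 0 (fintype.lift ord0 k) - lo k * v 0 ord0) [set x : R | 0 <= x]).
    by move=> v _; exact: coord_expr_continuous.
  exact: closed_ge.
apply: (@preimage_closed _ _
  (fun v : vec => v 0 (fintype.lift ord0 k) - hi k * v 0 ord0) [set x : R | x <= 0]).
  by move=> v _; exact: coord_expr_continuous.
exact: closed_le.
Qed.

Lemma cone_scale (a : R) v lo hi : 0 < a ->
  (open_cone_over lo hi v -> open_cone_over lo hi (a *: v)) /\
  (closed_cone_over lo hi v -> closed_cone_over lo hi (a *: v)).
Proof.
move=> a0; split=> -[v0 vk]; (split=> [|k]; rewrite !mxE).
- exact: mulr_gt0.
- by rewrite !(mulrCA _ a) !ltr_pM2l.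
- by rewrite mulr_ge0// ltW.
- by rewrite !(mulrCA _ a) !ler_pM2l.
Qed.

(** Cones live in the half space of positive first coordinate, which contains at
    most one of the two rays of a line; a projective point lies over a box if
    either ray does. *)
Definition symmetrization (U : vec -> Prop) (v : vec) : Prop := U v \/ U (- v).

Lemma symmetrization_scale (U : vec -> Prop) :
  (forall a v, 0 < a -> U v -> U (a *: v)) ->
  forall a v, a != 0 -> symmetrization U v -> symmetrization U (a *: v).
Proof.
move=> Uscale a v; rewrite neq_lt => /orP[a0|a0] [Uv|Uv].
- by right; rewrite -scaleNr; apply: (Uscale) => //; rewrite oppr_gt0.
- by left; rewrite -[v]opprK scalerN -scaleNr; apply: (Uscale) => //; rewrite oppr_gt0.
- by left; apply: (Uscale).
- by right; rewrite -scalerN; apply: (Uscale).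
Qed.

Lemma symmetrizationU (U : vec -> Prop) : symmetrization U = U `|` (fun v => - v) @^-1` U.
Proof. by []. Qed.

Hypothesis f_homog : f \is ishomog1 m mdeg.

Lemma representative_zero x : zero_vector f (representative x).
Proof.
split; first exact: set_valP (repr (set_val x)).
have [w fw wx] := set_valP x.
have /asboolP[a a0 xw] : proportional (repr (set_val x)) w.
  by apply/eqmodP; rewrite reprK wx.
have -> : representative x = a *: set_val w by exact: xw.
by rewrite (value_scale _ _ f_homog) [value _ _]fw mulr0.
Qed.

(** A nonzero vector of the closed cone has positive first coordinate, hence
    comes from a point of the box, and zeros in the box are interior by
    isolation. *)
Lemma closed_cone_open lo hi v : isolating_box lo hi -> zero_vector f v ->
  closed_cone_over lo hi v -> open_cone_over lo hi v.
Proof.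
move=> [isol _] [vn0 fv] [v0 vk].
have vpos : 0 < v 0 ord0.
  rewrite lt_def v0 andbT; apply: contraNneq vn0 => v00.
  apply/eqP/rowP => l; rewrite mxE; case: (unliftP ord0 l) => [k ->|->//].
  by apply/eqP; have := vk k; rewrite v00 !mulr0 eq_le andbC.
split=> // k.
pose p : 'rV[R]_n := \row_k (v 0 (fintype.lift ord0 k) / v 0 ord0).
have vp : chart_point p = (v 0 ord0)^-1 *: v.
  apply/rowP => l; rewrite !mxE; case: unliftP => [j ->|->].
    by rewrite mxE mulrC.
  by rewrite mulVf// gt_eqF.
have /isol/(_ _)/(_ k) : in_box lo hi p.
  by move=> j; rewrite mxE ler_pdivlMr// ler_pdivrMr.
rewrite mxE ltr_pdivlMr// ltr_pdivrMr//; apply.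
by rewrite vp (value_scale _ _ f_homog) fv mulr0.
Qed.

Definition inside lo hi (s : simplex 0) : bool :=
  `[< symmetrization (open_cone_over lo hi) (representative (s (vertex R))) >].

(** On the zero locus, the open cone and the closed cone over an isolating box
    coincide: the first shows that the points over the box form an open set, the
    second a closed one. *)
Lemma inside_end_invariant lo hi : isolating_box lo hi ->
  end_invariant (inside lo hi).
Proof.
move=> isol.
pose A := [set x : X | symmetrization (open_cone_over lo hi) (representative x)].
have opp_c : continuous (fun v : vec => - v) by exact: opp_continuous.
apply: (@clopen_end_invariant A).
  apply: open_cone; last first.
    by apply: symmetrization_scale => a v a0; exact: (@cone_scale a v lo hi a0).1.
  rewrite symmetrizationU; apply: (openU (@open_open_cone_over lo hi)).
  by apply: (@open_comp _ _ _ (open_cone_over lo hi)) => [v _|];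
    [exact: opp_c|exact: open_open_cone_over].
(* On zero vectors, not being over the open box is not being over the closed
   one, an open condition. *)
have -> : ~` A =
    [set x : X | (~` symmetrization (closed_cone_over lo hi)) (representative x)].
  apply/seteqP; split=> x nA sx; apply: nA.
    have [rx0 frx] := representative_zero x.
    case: sx => cx; [left|right]; apply: closed_cone_open => //.
    split; first by rewrite oppr_eq0.
    by rewrite -scaleN1r (value_scale _ _ f_homog) frx mulr0.
  have weak v : open_cone_over lo hi v -> closed_cone_over lo hi v.
    by move=> [v0 vk]; split=> [|k]; [exact: ltW|have /andP[/ltW-> /ltW->] := vk k].
  by case: sx => /weak; [left|right].
apply: open_cone.
  rewrite openC symmetrizationU; apply: (closedU (@closed_closed_cone_over lo hi)).
  by apply: (@preimage_closed _ _ _ (closed_cone_over lo hi)) => [v _|];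
    [exact: opp_c|exact: closed_closed_cone_over].
move=> a v a0 nv; apply: contra_not nv => sv.
rewrite -[v]scale1r -(mulVf a0) -scalerA.
apply: symmetrization_scale; rewrite ?invr_eq0// => b w b0; exact: (@cone_scale b w lo hi b0).2.
Qed.

Lemma chart_point_zero (p : 'rV[R]_n) : value f (chart_point p) = 0 ->
  zero_vector f (chart_point p).
Proof.
move=> fp; split=> //; apply/eqP => /rowP/(_ ord0).
by rewrite !mxE unlift_none => /eqP; rewrite oner_eq0.
Qed.

Lemma inside_chart_point lo hi p (fp : value f (chart_point p) = 0) :
  inside lo hi (zero_simplex (chart_point_zero fp)) <-> in_open_box lo hi p.
Proof.
have coneE : open_cone_over lo hi (chart_point p) <-> in_open_box lo hi p.
  split=> [[_ pk] k|pk]; first by have := pk k; rewrite !mxE unlift_none liftK !mulr1.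
  by split=> [|k]; rewrite !mxE unlift_none ?liftK ?mulr1.
have not_opp : ~ open_cone_over lo hi (- chart_point p).
  by move=> [+ _]; rewrite !mxE unlift_none oppr_gt0 ltr10.
rewrite -coneE.
set v := representative (zero_simplex (chart_point_zero fp) (vertex R)).
have /asboolP[a a0 va] :
    proportional (repr (\pi_(RP R n)%qT (nonzero (chart_point_zero fp))))
      (nonzero (chart_point_zero fp)).
  by apply/eqmodP; rewrite reprK.
have {}va : v = a *: chart_point p by exact: va.
have sc := symmetrization_scale (fun a v a0 => (@cone_scale a v lo hi a0).1).
split=> [/asboolP sv|pc].
  have {}sv : symmetrization (open_cone_over lo hi) v by exact: sv.
  move: sv; rewrite va => /(sc a^-1).
  by rewrite invr_eq0 scalerA mulVf// scale1r => /(_ a0)[].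
apply/asboolP; suff : symmetrization (open_cone_over lo hi) v by [].
by rewrite va; apply: sc => //; left.
Qed.

(** Each box contains a zero, and the parity functional of a box tells its zero
    from those of the other boxes. *)
Lemma components_lower_bound (I : finType) (lo hi : I -> 'I_n -> R) :
  nonsingular f ->
  (forall i, isolating_box (lo i) (hi i)) ->
  (forall i j p, in_open_box (lo i) (hi i) p -> in_open_box (lo j) (hi j) p ->
     i = j) ->
  exists2 b, (#|I| <= b)%N & betti R X 0 b.
Proof.
move=> fns isol disj.
have [es esP] := finite_classes f_homog fns.
have /choice[z zP] i : exists p, in_open_box (lo i) (hi i) p /\
    value f (chart_point p) = 0.
  by have [p pB fp] := box_zero (isol i); exists p.
pose u i := zero_simplex (chart_point_zero (zP i).2).
have uz i : inside (lo i) (hi i) (u i).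
  by apply/inside_chart_point; exact: (zP i).1.
apply: (betti0_finite_classes (u := u) esP) => i j uij.
apply: (disj i j (z j)); last exact: (zP j).1.
have := linked_invariant (inside_end_invariant (isol i)) uij.
by rewrite uz => /esym/inside_chart_point.
Qed.

End Separation.

(** * Stability of isolating boxes *)

Section Stability.
Variables (R : realType) (n : nat).
Local Notation pt := 'rV[R]_n.
Implicit Types (lo hi : 'I_n -> R).

Lemma box_compact lo hi : compact [set p : pt | in_box lo hi p].
Proof.
have := @rV_compact R n (fun k => `[lo k, hi k]%classic)
  (fun k => @segment_compact _ _ _).
congr compact; apply/seteqP; split=> p pB k; have := pB k;
  by rewrite /= in_itv.
Qed.

Lemma coordinate_continuous (k : 'I_n) : continuous (fun p : pt => p 0 k).
Proof. exact: coord_continuous. Qed.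

Lemma open_box_open lo hi : open [set p : pt | in_open_box lo hi p].
Proof.
rewrite openE => p pB; apply: (@filter_forall _ _ _ _ (nbhs_filter p)) => k.
have /andP[plo phi] := pB k.
have above : \forall q \near p, lo k < (q : pt) 0 k.
  exact: (cvgr_gt _ (@coordinate_continuous k p)).
have below : \forall q \near p, (q : pt) 0 k < hi k.
  exact: (cvgr_lt _ (@coordinate_continuous k p)).
by apply: filterS2 above below => q -> ->.
Qed.

(** Each point of the compact slice has a product neighbourhood where [H] is
    positive, and finitely many of these cover the slice. *)
Lemma positive_near (K : set pt) (H : pt * R -> R) :
  compact K -> continuous H -> (forall p, K p -> 0 < H (p, 0)) ->
  \forall c \near 0, forall p, K p -> 0 < H (p, c).
Proof.
move=> /compact_near_coveringP cptK cH Hpos.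
apply: (cptK R (nbhs 0) (fun c p => 0 < H (p, c))) => p Kp.
have [[A B] [nA nB] AB] := cvgr_gt _ (cH (p, 0)) _ (Hpos p Kp).
by exists (A, B) => // -[q c] /= qc; exact: (AB (q, c)).
Qed.

(** The three conditions, no zero on the compact boundary and a value of each
    sign, are strict. *)
Lemma isolating_box_near (f g : mpoly n.+1 R) lo hi : isolating_box f lo hi ->
  \forall c \near 0, isolating_box (f + c *: g) lo hi.
Proof.
move=> [isol [p [q [pB qB fp fq]]]].
pose H (x : pt * R) := value f (chart_point x.1) + x.2 * value g (chart_point x.1).
have HE x c : value (f + c *: g) (chart_point x) = H (x, c).
  by rewrite /value mevalD mevalZ.
have cH : continuous H.
  have cv (h : mpoly n.+1 R) : continuous (fun x : pt * R => value h (chart_point x.1)).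
    move=> x; apply: continuous_comp; last exact: value_continuous.
    by apply: continuous_comp; [exact: cvg_fst|exact: chart_point_continuous].
  move=> x; apply: cvgD; first exact: cv.
  by apply: cvgM; [exact: cvg_snd|exact: cv].
pose K := [set x : pt | in_box lo hi x] `&` ~` [set x : pt | in_open_box lo hi x].
have cptK : compact K.
  apply: compact_closedI; first exact: box_compact.
  by rewrite closedC; exact: open_box_open.
have nz : \forall c \near 0, forall x, K x -> 0 < H (x, c) * H (x, c).
  apply: (@positive_near K (fun x => H x * H x)) => //.
    by move=> x; apply: cvgM; exact: cH.
  move=> x [xB xO]; rewrite -expr2 exprn_even_gt0//= -HE scale0r addr0.
  by apply/eqP => /(isol _ xB).
have neg : \forall c \near 0, forall x, [set p] x -> 0 < - H (x, c).
  apply: (@positive_near [set p] (fun x => - H x)); first exact: compact_set1.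
    by move=> x; apply: cvgN; exact: cH.
  by move=> _ ->; rewrite -HE scale0r addr0 oppr_gt0.
have pos : \forall c \near 0, forall x, [set q] x -> 0 < H (x, c).
  apply: (@positive_near [set q] H) => //; first exact: compact_set1.
  by move=> _ ->; rewrite -HE scale0r addr0.
apply: filterS3 nz neg pos => c nzc negc posc.
split=> [x xB|].
  rewrite HE => Hx; apply: contrapT => xO.
  by have := nzc x (conj xB xO); rewrite Hx mul0r ltxx.
exists p, q; split=> //; rewrite HE; last exact: posc.
by rewrite -oppr_gt0; exact: negc.
Qed.

End Stability.

(** * Polynomials in powers of X and of 1 - X *)

Section PowersOfOneMinusX.
Variables (K : fieldType) (m : nat).
Hypothesis m_neq0 : m%:R != 0 :> K.
Implicit Types Q : {poly K}.

Let L : {poly K} := (1 - 'X) ^+ m.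

(** The zero of [(1 - X)^m - 1] at the origin is simple: the derivative there is
    [- m]. *)
Lemma one_subX_factor : exists2 U : {poly K}, L - 1 = U * 'X & U.[0] != 0.
Proof.
have /factor_theorem[U LU] : root (L - 1) 0.
  by rewrite /root !hornerE subr0 expr1n subrr.
rewrite subr0 in LU; exists U => //.
have : (L - 1)^`().[0] = - m%:R.
  rewrite derivB derivC subr0 deriv_exp derivB derivC derivX sub0r.
  by rewrite mulN1r hornerMn hornerN horner_exp !hornerE subr0 expr1n mulNrn.
rewrite LU derivM derivX !hornerE => ->.
by rewrite oppr_eq0.
Qed.

(** Since [(1 - X)^m - 1] has a simple zero at the origin, the order of [Q((1 -
    X)^m)] at 0 is the order of [Q] at 1, which is at most the degree of [Q]. *)
Lemma dvd_comp_size k Q : 'X^k %| Q \Po L -> Q = 0 \/ (k < size Q)%N.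
Proof.
elim: k Q => [|k IH] Q kQ.
  by case: (eqVneq Q 0) => [->|Q0]; [left|right; rewrite size_poly_gt0].
have [U LU U0] := one_subX_factor.
have /factor_theorem[Q' QE] : root Q 1.
  have : root (Q \Po L) 0.
    rewrite -dvdp_XsubCl subr0; apply: dvdp_trans kQ.
    by rewrite exprS dvdp_mulIl.
  by rewrite /root horner_comp !hornerE subr0 expr1n.
have [Q'0|Q'0] := eqVneq Q' 0; first by left; rewrite QE Q'0 mul0r.
right; rewrite QE size_Mmonic ?monicXsubC// size_XsubC addn2/= ltnS.
have [|/eqP|//] := IH Q'; last by rewrite (negbTE Q'0).
move: kQ; rewrite QE comp_polyM comp_polyB comp_polyX comp_polyC LU.
rewrite exprSr mulrA dvdp_mul2r ?polyX_eq0// mulrC Gauss_dvdpr//.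
by rewrite coprimep_expl// coprimep_sym -['X]subr0 coprimep_XsubC.
Qed.

(** Algebraic independence of [X^m] and [(1 - X)^m] in low degrees. Peel off the
    powers of [X^m]: the first coefficient composed with [(1 - X)^m] is
    divisible by [X^m], hence vanishes by [dvd_comp_size]. *)
Lemma comp_sum_eq0 N (Q : nat -> {poly K}) :
  (forall c, (size (Q c) <= m)%N) ->
  \sum_(c < N) 'X^(m * c) * (Q c \Po L) = 0 ->
  forall c, (c < N)%N -> Q c = 0.
Proof.
elim: N Q => [//|N IH] Q sQ; rewrite big_ord_recl muln0 expr0 mul1r.
under eq_bigr do rewrite lift0 mulnS exprD -mulrA.
rewrite -mulr_sumr => sum0.
have Q0 : Q 0%N = 0.
  have [|//|] := @dvd_comp_size m (Q 0%N); last by rewrite ltnNge sQ.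
  by move/eqP: sum0; rewrite addr_eq0 => /eqP ->; rewrite dvdpNr dvdp_mulIl.
move: sum0; rewrite Q0 comp_poly0 add0r => /eqP.
rewrite mulf_eq0 expf_eq0 polyX_eq0 andbF /= => /eqP rest.
by case=> [//|c] cN; apply: (IH (fun c => Q c.+1)).
Qed.

End PowersOfOneMinusX.

(** * The norm form of a line *)

Section FermatNorm.
Variable m : nat.

Definition signed_binomial (A : nzRingType) (k : nat) : A :=
  (-1) ^+ k * ('C(m, k))%:R.

(** The matrix of multiplication by [y - (1 - t)^m] in the basis of powers of
    [t] of the algebra where [t^m = x], with [a] homogenizing: each entry is a
    linear form in [a], [x] and [y]. *)
Definition norm_matrix (A : comNzRingType) (a x y : A) : 'M[A]_m :=
  \matrix_(i, j) (y *+ (i == j) -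
    \sum_(k < m.+1 | ((i + k) %% m == j)%N)
      (if (i + k < m)%N then a else x) * signed_binomial A k).

(** The norm of [y - (1 - t)^m]. At [a = 1] it is the equation of the image of
    the line [u + v = 1] under [(u, v) |-> (u^m, v^m)]; as a determinant of
    linear forms it is visibly a form of degree [m]. *)
Definition norm_form (A : comNzRingType) (a x y : A) : A :=
  \det (norm_matrix a x y).

Lemma norm_form_rmorph (A B : comNzRingType) (g : {rmorphism A -> B}) a x y :
  g (norm_form a x y) = norm_form (g a) (g x) (g y).
Proof.
rewrite /norm_form -det_map_mx; congr (\det _); apply/matrixP => i j.
rewrite !mxE rmorphB rmorphMn rmorph_sum; congr (_ - _).
apply: eq_bigr => k _; rewrite rmorphM; congr (_ * _); first by case: ifP.
by rewrite /signed_binomial rmorphM rmorphXn rmorphN rmorph1 rmorph_nat.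
Qed.

Lemma expr_1B (A : comNzRingType) (t : A) :
  (1 - t) ^+ m = \sum_(k < m.+1) signed_binomial A k * t ^+ k.
Proof.
rewrite exprBn; apply: eq_bigr => k _.
by rewrite expr1n mulr1 /signed_binomial -mulr_natr mulrAC.
Qed.

(** The powers of a number [t] form an eigenvector, since they realize the
    algebra homomorphism that sends the generator to [t]. *)
Lemma norm_matrix_eigen (A : comNzRingType) (t y : A) (i : 'I_m) :
  \sum_j norm_matrix 1 (t ^+ m) y i j * t ^+ j = t ^+ i * (y - (1 - t) ^+ m).
Proof.
under eq_bigr do rewrite mxE mulrBl.
rewrite sumrB mulrBr; congr (_ - _).
  rewrite (bigD1 i)//= eqxx mulr1n big1 ?addr0 1?mulrC// => j ji.
  by rewrite eq_sym (negbTE ji) mul0r.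
rewrite expr_1B mulr_sumr.
under eq_bigr do rewrite mulr_suml.
rewrite (exchange_big_dep predT)//=; apply: eq_bigr => k _.
have m_gt0 : (0 < m)%N by apply: leq_ltn_trans (ltn_ord i).
pose j0 := Ordinal (ltn_pmod (i + k) m_gt0).
rewrite (big_pred1 j0) => [|j]; last first.
  by apply/eqP/eqP => [jE|->//]; apply: val_inj.
rewrite /= mulrAC mulrC [RHS]mulrCA; congr (_ * _).
have [ikm|mik] := ltnP (i + k) m.
  by rewrite mul1r modn_small// exprD.
have -> : ((i + k) %% m = i + k - m)%N.
  rewrite -{1}(subnK mik) modnDr modn_small//.
  by have := ltn_ord i; have := ltn_ord k; lia.
by rewrite -exprD subnKC// exprD.
Qed.

(** The [m] roots of [t^m = u^m] give [m] independent eigenvectors, the columns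
    of a Vandermonde matrix, so the norm is the product of the eigenvalues. *)
Lemma norm_form_prod (K : fieldType) (w u y : K) :
  m.-primitive_root w -> u != 0 ->
  norm_form 1 (u ^+ m) y = \prod_(r < m) (y - (1 - w ^+ r * u) ^+ m).
Proof.
move=> wm u0.
pose t (r : 'I_m) := w ^+ r * u.
pose V := Vandermonde m (\row_r t r).
have tm r : t r ^+ m = u ^+ m.
  by rewrite exprMn exprAC (prim_expr_order wm) expr1n mul1r.
have V0 : \det V != 0.
  rewrite det_Vandermonde; apply/prodf_neq0 => i _; apply/prodf_neq0 => j ij.
  rewrite !mxE subr_eq0 (inj_eq (mulIf u0)) (eq_prim_root_expr wm).
  by rewrite !modn_small// gtn_eqF.
have MV : norm_matrix 1 (u ^+ m) y *m V =
    V *m diag_mx (\row_r (y - (1 - t r) ^+ m)).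
  apply/matrixP => i r; rewrite mul_mx_diag !mxE -norm_matrix_eigen tm.
  by apply: eq_bigr => j _; rewrite !mxE.
apply: (mulIf V0); rewrite /norm_form -det_mulmx MV det_mulmx det_diag mulrC.
by congr (_ * _); apply: eq_bigr => r _; rewrite mxE.
Qed.

End FermatNorm.

Lemma dhomog_prod_const (A : comNzRingType) (k : nat) (I : Type) (s : seq I)
    (G : I -> mpoly k A) (d : nat) :
  (forall i, G i \is ishomog1 d mdeg) ->
  \prod_(i <- s) G i \is ishomog1 (d * size s) mdeg.
Proof.
move=> Gd; elim: s => [|i s IH]; first by rewrite big_nil muln0 dhomog1.
by rewrite big_cons mulnS; apply: dhomogM.
Qed.

Lemma dhomog_det (A : comNzRingType) (k d : nat) (M : 'M[mpoly k A]_d) :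
  (forall i j, M i j \is ishomog1 1 mdeg) -> \det M \is ishomog1 d mdeg.
Proof.
move=> M1; rewrite /determinant rpred_sum// => s _.
have Md : \prod_i M i (perm.fun_of_perm s i) \is ishomog1 d mdeg.
  have := dhomog_prod_const (index_enum 'I_d)
    (fun i => M1 i (perm.fun_of_perm s i)).
  by rewrite mul1n -[index_enum _]enumT size_enum_ord.
by rewrite -signr_odd; case: (odd _); rewrite ?expr1 ?mulN1r ?rpredN ?expr0 ?mul1r.
Qed.

Lemma dhomog_norm_form (A : comNzRingType) (k m : nat) (a x y : mpoly k A) :
  a \is ishomog1 1 mdeg -> x \is ishomog1 1 mdeg -> y \is ishomog1 1 mdeg ->
  norm_form m a x y \is ishomog1 m mdeg.
Proof.
move=> a1 x1 y1; apply: dhomog_det => i j; rewrite mxE.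
apply: rpredB; first by rewrite rpredMn.
apply: rpred_sum => l _; rewrite mulrC.
have -> : signed_binomial m (mpoly k A) l = mpolyC k (signed_binomial m A l).
  by rewrite /signed_binomial rmorphM rmorphXn rmorphN rmorph1 rmorph_nat.
by rewrite mul_mpolyC rpredZ//; case: ifP.
Qed.

(** * Solitary points of the norm form *)

Section OddPowers.
Variables (R : rcfType) (m : nat).
Hypothesis m_odd : odd m.

Lemma ltr_odd_pow : {mono (fun x : R => x ^+ m) : x y / x < y}.
Proof.
have m0 : (0 < m)%N by case: m m_odd.
apply: leW_mono; apply: le_mono => x y xy.
have oppE (z : R) : z ^+ m = - (- z) ^+ m.
  by rewrite exprNn -signr_odd m_odd expr1 mulN1r opprK.
have [y0|y0] := leP y 0.
  rewrite (oppE x) (oppE y) ltrN2 ltr_pXn2r ?nnegrE ?oppr_ge0 ?ltrN2//.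
  exact: le_trans (ltW xy) y0.
have [x0|x0] := leP 0 x; first by rewrite ltr_pXn2r// nnegrE ltW.
by apply: lt_trans (exprn_gt0 m y0); rewrite exprn_odd_lt0.
Qed.

Lemma odd_pow_inj : injective (fun x : R => x ^+ m).
Proof.
by move=> x y /= e; case: (ltgtP x y) => //; rewrite -ltr_odd_pow e ltxx.
Qed.

(** Intermediate value theorem between two numbers whose powers frame [x]. *)
Lemma odd_root (x : R) : exists u, u ^+ m = x.
Proof.
have m0 : (0 < m)%N by case: m m_odd.
pose a := 1 + `|x|.
have a1 : 1 <= a by rewrite lerDl.
have xa : `|x| <= a ^+ m.
  by rewrite (le_trans _ (ler_eXnr m0 a1))// lerDr.
have na : (- a) ^+ m = - a ^+ m by rewrite exprNn -signr_odd m_odd mulN1r.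
have [||u _ /rootP] := @poly_ivt _ ('X^m - x%:P) (- a) a.
- by rewrite -subr_ge0 opprK addr_ge0// (le_trans ler01).
- rewrite !hornerE na; move: xa; rewrite ler_norml => /andP[xa1 xa2].
  by apply/andP; split; lra.
- by rewrite !hornerE => /eqP; rewrite subr_eq0 => /eqP <-; exists u.
Qed.

End OddPowers.

(** In characteristic prime to [m] the polynomial [X^m - 1] is separable, so it
    has [m] roots, and a finite group of roots of unity is cyclic. *)
Lemma primitive_root_exists (K : closedFieldType) (m : nat) :
  m%:R != 0 :> K -> exists w : K, m.-primitive_root w.
Proof.
move=> mK; have m0 : (0 < m)%N by case: m mK; rewrite ?eqxx.
have [rs rsE] := closed_field_poly_normal ('X^m - 1 : {poly K}).
have lc : lead_coef ('X^m - 1 : {poly K}) = 1.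
  by rewrite lead_coefXnsubC.
rewrite lc scale1r in rsE.
have : has m.-primitive_root rs.
  apply: cyclic.has_prim_root => //.
  - apply/allP => z zrs; have : root ('X^m - 1) z by rewrite rsE root_prod_XsubC.
    by rewrite /root !hornerE subr_eq0 /= unity_rootE.
  - by rewrite -separable.separable_prod_XsubC -rsE; exact: cyclotomic.separable_Xn_sub_1.
  - have := size_XnsubC (1 : K) m0; rewrite rsE size_prod_XsubC => -[->]; exact: leqnn.
by move=> /hasP[w _]; exists w.
Qed.

(** Groups the factors of indices [r] and [m - r], which will be complex
    conjugate. *)
Lemma prod_pair (A : comNzRingType) (c : nat -> A) (q : nat) :
  \prod_(r < q.*2.+1) c r = c 0 * \prod_(r < q) (c r.+1 * c (q.*2.+1 - r.+1)%N).
Proof.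
rewrite big_ord_recl; congr (_ * _).
rewrite -addnn big_split_ord/= [X in _ * X](reindex_inj rev_ord_inj)/=.
rewrite -big_split/=; apply: eq_bigr => r _; congr (_ * c _).
by rewrite /bump/=; have := ltn_ord r; lia.
Qed.

Section ConjugateNodes.
Variables (R : rcfType) (C : closedFieldType).
Variables (iota : {rmorphism R -> C}) (conj : {rmorphism C -> C}).
Hypothesis conjK : involutive conj.
Hypothesis conj_iota : forall x, conj (iota x) = iota x.
Hypothesis conj_fixed : forall z, conj z = z -> exists x, z = iota x.
Hypothesis norm_ge0 : forall z, exists x,
  [/\ 0 <= x, z * conj z = iota x & x = 0 -> z = 0].
Variables (q : nat) (w : C).
Local Notation m := q.*2.+1.
Hypothesis w_prim : m.-primitive_root w.

Let m_odd : odd m. Proof. by rewrite /= odd_double. Qed.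

Let w_neq0 : w != 0.
Proof.
by apply: contra_eq_neq (prim_expr_order w_prim) => ->; rewrite expr0n/= eq_sym oner_eq0.
Qed.

(** The norm of [z] is a nonnegative real [m]-th root of 1, hence 1. *)
Lemma conj_unity_root z : z ^+ m = 1 -> conj z = z^-1.
Proof.
move=> zm; have [x [x0 zx _]] := norm_ge0 z.
have z0 : z != 0.
  by apply: contra_eq_neq zm => ->; rewrite expr0n/= eq_sym oner_eq0.
have xm : x ^+ m = 1.
  apply: (fmorph_inj iota); rewrite rmorphXn -zx exprMn zm mul1r.
  by rewrite -rmorphXn zm !rmorph1.
have x1 : x = 1 by apply: (odd_pow_inj m_odd); rewrite expr1n.
by apply: (mulfI z0); rewrite zx x1 rmorph1 divff.
Qed.

(** In the product formula the factor of index 0 is real, and the others come in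
    conjugate pairs whose products are nonnegative. So the sign of the norm form
    is the side of the arc [u + v = 1], and the points off that arc where it
    vanishes are extrema. *)
Lemma norm_form_sign (u v : R) : u != 0 -> exists P : R,
  [/\ 0 <= P, norm_form m 1 (u ^+ m) (v ^+ m) = (v ^+ m - (1 - u) ^+ m) * P
    & P = 0 -> exists2 r, (0 < r < m)%N & (1 - w ^+ r * iota u) ^+ m = iota v ^+ m].
Proof.
move=> u0.
pose c r := iota v ^+ m - (1 - w ^+ r * iota u) ^+ m.
have conj_c r : (r < q)%N -> conj (c r.+1) = c (m - r.+1)%N.
  move=> rq; rewrite /c rmorphB !rmorphXn !rmorphB rmorph1 rmorphM !conj_iota.
  congr (_ - (_ - _ * _) ^+ _).
  rewrite rmorphXn (conj_unity_root (prim_expr_order w_prim)) exprVn.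
  apply: (mulfI (expf_neq0 r.+1 w_neq0)).
  rewrite divff ?expf_neq0 ?w_neq0// -exprD subnKC ?prim_expr_order//.
  by rewrite -addnn; lia.
have /choice[x xP] r : exists x : R, (r < q)%N ->
    [/\ 0 <= x, c r.+1 * c (m - r.+1)%N = iota x & x = 0 -> c r.+1 = 0].
  have [rq|rq] := ltnP r q; last by exists 0.
  by have [x xP] := norm_ge0 (c r.+1); exists x => _; rewrite -conj_c.
exists (\prod_(r < q) x r); split.
- by apply: prodr_ge0 => r _; have [] := xP r (ltn_ord r).
- apply: (fmorph_inj iota); rewrite norm_form_rmorph rmorph1 !rmorphXn.
  rewrite (norm_form_prod _ w_prim) ?fmorph_eq0// -/c.
  rewrite rmorphM rmorphB !rmorphXn rmorphB rmorph1 rmorph_prod.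
  rewrite (prod_pair c) /c expr0 mul1r; congr (_ * _).
  by apply: eq_bigr => r _; have [_ <- _] := xP r (ltn_ord r).
- move=> /eqP/prodf_eq0[r _ /eqP xr0]; have [_ _ /(_ xr0) cr0] := xP r (ltn_ord r).
  exists r.+1; first by rewrite /= -addnn; have := ltn_ord r; lia.
  by apply/eqP; rewrite eq_sym -subr_eq0; apply/eqP.
Qed.

Lemma norm_form_zero (u v : R) r : u != 0 ->
  (1 - w ^+ r * iota u) ^+ m = iota v ^+ m -> norm_form m 1 (u ^+ m) (v ^+ m) = 0.
Proof.
move=> u0 ruv; apply: (fmorph_inj iota).
rewrite norm_form_rmorph rmorph1 !rmorphXn rmorph0.
rewrite (norm_form_prod _ w_prim) ?fmorph_eq0//.
have rm : (r %% m < m)%N by rewrite ltn_pmod.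
by rewrite (bigD1 (Ordinal rm))//= prim_expr_mod// ruv subrr mul0r.
Qed.

(** The complex parameter [t] of a solitary point: [t] and [1 - t] have
    arguments that are multiples of [pi / m], which means that [t / conj t =
    w^a] and [(1 - t) / conj (1 - t) = w^b]; these two linear equations in [t]
    and [conj t] are solved here. *)
Definition node_point (a b : nat) : C := conj ((w ^+ b - 1) / (w ^+ b - w ^+ a)).

Definition node_index (a b : nat) : bool :=
  [&& (0 < a < m)%N, (0 < b < m)%N & a != b].

Let w_eq1 a : (0 < a < m)%N -> w ^+ a != 1.
Proof.
move=> /andP[a0 am]; rewrite -(expr0 w) (eq_prim_root_expr w_prim).
by rewrite !modn_small// -lt0n.
Qed.

Let w_inj a b : (a < m)%N -> (b < m)%N -> w ^+ a = w ^+ b -> a = b.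
Proof.
by move=> am bm /eqP; rewrite (eq_prim_root_expr w_prim) !modn_small// => /eqP.
Qed.

Let w_neq a b : node_index a b -> w ^+ b - w ^+ a != 0.
Proof.
move=> /and3P[/andP[_ am] /andP[_ bm] ab]; rewrite subr_eq0.
by apply: contraNneq ab => /w_inj ->.
Qed.

Let conj_w a : conj (w ^+ a) = (w ^+ a)^-1.
Proof. by apply: conj_unity_root; rewrite exprAC (prim_expr_order w_prim) expr1n. Qed.

Lemma node_pointP a b : node_index a b ->
  node_point a b = w ^+ a * conj (node_point a b) /\
  1 - node_point a b = w ^+ b * (1 - conj (node_point a b)).
Proof.
move=> ab; have nab := w_neq ab.
have a0 : w ^+ a != 0 by rewrite expf_neq0.
have b0 : w ^+ b != 0 by rewrite expf_neq0.
rewrite /node_point conjK rmorphM rmorphV ?unitfE// !rmorphB rmorph1 !conj_w.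
have nba : w ^+ a - w ^+ b != 0 by rewrite -oppr_eq0 opprB.
by split; field; rewrite nab a0 b0 mulN1r nba.
Qed.

Lemma node_point_unique a b t : node_index a b ->
  t = w ^+ a * conj t -> 1 - t = w ^+ b * (1 - conj t) -> t = node_point a b.
Proof.
move=> ab ta tb; have nab := w_neq ab.
apply: (can_inj conjK); rewrite conjK; apply: (mulIf nab); rewrite divfK//.
move: tb; rewrite {1}ta => tb.
transitivity (w ^+ b - w ^+ b * (1 - conj t) - w ^+ a * conj t); first by ring.
by rewrite -tb; ring.
Qed.

Lemma node_index_conj a b : node_index a b -> node_index (m - a) (m - b).
Proof. by rewrite /node_index; lia. Qed.

(** Conjugate parameters give the same real point, so that indices count twice
    each solitary point; the order [a < b] selects one of the two. *)
Lemma conj_node_point a b : node_index a b ->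
  conj (node_point a b) = node_point (m - a) (m - b).
Proof.
move=> ab; have [ta tb] := node_pointP ab.
have inv c : (c <= m)%N -> w ^+ (m - c) = (w ^+ c)^-1.
  move=> cm; apply: (mulfI (expf_neq0 c w_neq0)).
  by rewrite divff ?expf_neq0// -exprD subnKC// prim_expr_order.
have /and3P[/andP[a0 am] /andP[b0 bm] nab] := ab.
apply: node_point_unique.
- exact: node_index_conj.
- by rewrite conjK inv ?(ltnW am)// {2}ta mulKf// expf_neq0.
- by rewrite conjK inv ?(ltnW bm)// tb mulKf// expf_neq0.
Qed.

Lemma node_point_neq0 a b : node_index a b ->
  node_point a b != 0 /\ 1 - node_point a b != 0.
Proof.
move=> ab; have nab := w_neq ab; have /and3P[a0 b0 _] := ab.
have t0 : node_point a b != 0.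
  by rewrite fmorph_eq0 mulf_neq0 ?invr_eq0// subr_eq0 w_eq1.
split=> //; rewrite subr_eq0; apply/eqP => t1.
have [ta _] := node_pointP ab; move: ta; rewrite -t1 rmorph1 mulr1 => /esym/eqP.
by rewrite (negbTE (w_eq1 a0)).
Qed.

Lemma node_point_nonreal a b : node_index a b ->
  conj (node_point a b) != node_point a b.
Proof.
move=> ab; have [ta _] := node_pointP ab; have [t0 _] := node_point_neq0 ab.
have /and3P[a0 _ _] := ab.
apply/eqP => tt; move: ta; rewrite tt -{1}[node_point a b]mul1r => /(mulIf t0)/esym/eqP.
by rewrite (negbTE (w_eq1 a0)).
Qed.

Lemma node_point_inj a b a' b' : node_index a b -> node_index a' b' ->
  node_point a b = node_point a' b' -> a = a' /\ b = b'.
Proof.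
move=> ab ab' tt; have [ta tb] := node_pointP ab; have [ta' tb'] := node_pointP ab'.
have [t0 t1] := node_point_neq0 ab.
have /and3P[/andP[_ am] /andP[_ bm] _] := ab.
have /and3P[/andP[_ am'] /andP[_ bm'] _] := ab'.
split; apply: w_inj => //.
  have c0 : conj (node_point a b) != 0 by rewrite fmorph_eq0.
  by apply: (mulIf c0); rewrite -ta tt -ta'.
have c0 : 1 - conj (node_point a b) != 0 by rewrite -(rmorph1 conj) -rmorphB fmorph_eq0.
by apply: (mulIf c0); rewrite -tb tt -tb'.
Qed.

(** The point of parameter [t] is [(t^m, (1 - t)^m)]. At a node its coordinates
    are real, and [u] and [v] are their real [m]-th roots, unique since [m] is
    odd. *)
Definition is_node (a b : nat) (u v : R) : Prop :=
  node_point a b ^+ m = iota u ^+ m /\ (1 - node_point a b) ^+ m = iota v ^+ m.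

Lemma real_pow (z : C) (e : nat) : z = w ^+ e * conj z ->
  exists u, z ^+ m = iota u ^+ m.
Proof.
move=> ze; have [|x zx] := @conj_fixed (z ^+ m).
  by rewrite rmorphXn [in RHS]ze exprMn exprAC (prim_expr_order w_prim) expr1n mul1r.
by have [u ux] := odd_root m_odd x; exists u; rewrite zx -ux rmorphXn.
Qed.

Lemma node_exists a b : node_index a b -> exists u v, is_node a b u v.
Proof.
move=> /node_pointP[ta tb]; have [u tu] := real_pow ta.
have [|v tv] := @real_pow (1 - node_point a b) b; last by exists u, v.
by rewrite rmorphB rmorph1.
Qed.

(** Both sides are nonnegative with the same [m]-th power. *)
Lemma conj_norm (z : C) (u : R) : z ^+ m = iota u ^+ m ->
  z * conj z = iota (u ^+ 2).
Proof.
move=> zu; have [x [x0 zx _]] := norm_ge0 z; rewrite zx; congr (iota _).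
apply: (odd_pow_inj m_odd); apply: (fmorph_inj iota).
rewrite rmorphXn -zx exprMn -rmorphXn zu !rmorphXn conj_iota -expr2.
exact: exprAC.
Qed.

(** The coordinates of a node determine [t * conj t] and [t + conj t], hence [t]
    up to conjugation. *)
Lemma node_norms a b u v : is_node a b u v ->
  node_point a b * conj (node_point a b) = iota (u ^+ 2) /\
  node_point a b + conj (node_point a b) = iota (1 + u ^+ 2 - v ^+ 2).
Proof.
move=> [tu tv]; have Nu := conj_norm tu; have Nv := conj_norm tv; split=> //.
rewrite rmorphB rmorphD rmorph1 -Nu -Nv rmorphB rmorph1; ring.
Qed.

Lemma node_u_neq0 a b u v : node_index a b -> is_node a b u v -> u != 0.
Proof.
move=> /node_point_neq0[t0 _] [tu _].
apply/eqP => u0; move/eqP: tu.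
by rewrite u0 rmorph0 expr0n/= expf_eq0 (negbTE t0) andbF.
Qed.

(** If [u + v = 1], then [u] is a root of the real quadratic polynomial whose
    roots are [t] and its conjugate, which are not real. *)
Lemma node_off_line a b u v : node_index a b -> is_node a b u v -> u + v != 1.
Proof.
move=> ab /node_norms[Np Ns]; apply/eqP => uv.
have vE : v = 1 - u by rewrite -uv addrAC subrr add0r.
have : (node_point a b - iota u) * (conj (node_point a b) - iota u) == 0.
  transitivity (node_point a b * conj (node_point a b)
    - iota u * (node_point a b + conj (node_point a b)) + iota u ^+ 2 == 0).
    by congr (_ == _); ring.
  rewrite Np Ns -rmorphXn -rmorphM -rmorphB -rmorphD fmorph_eq0 vE.
  by apply/eqP; ring.
have := node_point_nonreal ab.
rewrite mulf_eq0 !subr_eq0 => nr /orP[|] /eqP tu.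
  by move: nr; rewrite tu conj_iota eqxx.
by move: nr; rewrite -[X in _ != X]conjK tu conj_iota eqxx.
Qed.

Lemma node_inj a b a' b' u v : node_index a b -> node_index a' b' ->
  (a < b)%N -> (a' < b')%N -> is_node a b u v -> is_node a' b' u v ->
  a = a' /\ b = b'.
Proof.
move=> ab ab' lab lab' /node_norms[Np Ns] /node_norms[Np' Ns'].
have : (node_point a' b' - node_point a b) *
    (node_point a' b' - conj (node_point a b)) == 0.
  transitivity (node_point a' b' ^+ 2 - node_point a' b' *
    (node_point a b + conj (node_point a b)) +
    node_point a b * conj (node_point a b) == 0); first by congr (_ == _); ring.
  by rewrite Np Ns -Np' -Ns'; apply/eqP; ring.
rewrite mulf_eq0 !subr_eq0 => /orP[|] /eqP.
  by move=> /(node_point_inj ab' ab)[-> ->].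
rewrite conj_node_point// => /(node_point_inj ab').
have /and3P[/andP[a0 am] /andP[b0 bm] _] := ab.
have /and3P[/andP[_ am'] /andP[_ bm'] _] := ab'.
by case; rewrite /node_index; lia.
Qed.

Lemma node_is_zero a b u v : node_index a b -> is_node a b u v ->
  norm_form m 1 (u ^+ m) (v ^+ m) = 0.
Proof.
move=> ab uv; have u0 := node_u_neq0 ab uv; have [tu tv] := uv.
have iu0 : iota u != 0 by rewrite fmorph_eq0.
have : (node_point a b / iota u) ^+ m = 1.
  by rewrite expr_div_n tu divff// expf_neq0.
move=> /(prim_rootP w_prim)[r tr].
apply: (@norm_form_zero _ _ r) => //.
by rewrite -tr divfK.
Qed.

(** A zero of the norm form off the arc [u + v = 1] is the image of [t = w^r u],
    a nonreal number such that [t^m] and [(1 - t)^m] are real; the quotients of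
    [t] and of [1 - t] by their conjugates are then [m]-th roots of unity,
    different from 1 and from each other. *)
Lemma zero_is_node (u v : R) r : u != 0 -> (0 < r < m)%N ->
  (1 - w ^+ r * iota u) ^+ m = iota v ^+ m ->
  exists a b, [/\ node_index a b, (a < b)%N & is_node a b u v].
Proof.
move=> u0 rm tv; set t := w ^+ r * iota u in tv.
have iu0 : iota u != 0 by rewrite fmorph_eq0.
have ct : conj t = (w ^+ r)^-1 * iota u by rewrite rmorphM conj_w conj_iota.
have wr0 : w ^+ r != 0 by rewrite expf_neq0.
have t0 : t != 0 by rewrite mulf_neq0.
have ct0 : conj t != 0 by rewrite fmorph_eq0.
have nonreal : conj t != t.
  apply/eqP; rewrite ct => /(mulIf iu0) wrr.
  have : (w ^+ r) ^+ 2 == 1 by rewrite expr2 -{1}wrr mulVf.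
  rewrite -exprM -(prim_order_dvd w_prim); have /andP[r0 rltm] := rm.
  have cop : coprime m 2 by rewrite coprimen2.
  rewrite Gauss_dvdl// => /dvdn_leq; rewrite r0 => /(_ isT).
  by rewrite leqNgt rltm.
have t1 : 1 - t != 0.
  by rewrite subr_eq0; apply: contraNneq nonreal => <-; rewrite rmorph1.
have ct1 : 1 - conj t != 0 by rewrite -(rmorph1 conj) -rmorphB fmorph_eq0.
have tu : t ^+ m = iota u ^+ m.
  by rewrite exprMn exprAC (prim_expr_order w_prim) expr1n mul1r.
have ratio z s : z ^+ m = iota s ^+ m -> z != 0 -> conj z != 0 ->
    exists2 a, (a < m)%N & z = w ^+ a * conj z.
  move=> zs z0 cz0.
  have : (z / conj z) ^+ m = 1.
    by rewrite expr_div_n -rmorphXn zs rmorphXn conj_iota -zs divff// expf_neq0.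
  by move=> /(prim_rootP w_prim)[a za]; exists a => //; rewrite -za divfK.
have [a am ta] := ratio _ _ tu t0 ct0.
have cB : conj (1 - t) = 1 - conj t by rewrite rmorphB rmorph1.
have [|b bm] := ratio _ _ tv t1; first by rewrite cB.
rewrite cB => tb.
have a0 : (0 < a)%N.
  by rewrite lt0n; apply: contraNneq nonreal => a0; rewrite {2}ta a0 expr0 mul1r.
have b0 : (0 < b)%N.
  rewrite lt0n; apply: contraNneq nonreal => b0; move: tb.
  by rewrite b0 expr0 mul1r => /addrI/oppr_inj <-.
have ab : a != b.
  apply: contraTneq a0 => ab; move: tb; rewrite -ab mulrBr mulr1 -ta => /addIr.
  by move=> /esym w1; rewrite -leqNgt leqn0; apply/eqP/w_inj.
have abP : node_index a b by rewrite /node_index a0 am b0 bm.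
have tE := node_point_unique abP ta tb.
have [ltab|ltba|/eqP] := ltngtP a b; last by rewrite (negbTE ab).
  by exists a, b; split=> //; split; rewrite -tE.
exists (m - a)%N, (m - b)%N; split; [exact: node_index_conj|exact: ltn_sub2l|].
rewrite /is_node -conj_node_point// -tE; split.
  by rewrite -rmorphXn tu rmorphXn conj_iota.
by rewrite -cB -(rmorphXn conj) tv rmorphXn conj_iota.
Qed.

Lemma is_node_conj a b u v : node_index a b -> is_node a b u v ->
  is_node (m - a) (m - b) u v.
Proof.
move=> ab [tu tv]; rewrite /is_node -conj_node_point//.
have -> : 1 - conj (node_point a b) = conj (1 - node_point a b).
  by rewrite rmorphB rmorph1.
by split; rewrite -(rmorphXn conj) ?tu ?tv rmorphXn conj_iota.
Qed.

Local Notation node_pair := {p : 'I_q.*2 * 'I_q.*2 | (p.1 < p.2)%N}.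

Lemma node_pair_index (p : 'I_q.*2 * 'I_q.*2) : p.1 != p.2 ->
  node_index p.1.+1 p.2.+1.
Proof.
by move=> p12; rewrite /node_index !ltnS !leq0n !ltn_ord eqSS.
Qed.

Section Interpolation.
Hypothesis q_gt0 : (0 < q)%N.
Variables U V : node_pair -> R.
Hypothesis UV_node : forall p : node_pair, is_node (val p).1.+1 (val p).2.+1 (U p) (V p).

(** The monomials of degree at most [m - 3], indexed by the same set as the
    nodes: the pair [(a, b)] with [a < b < m - 1] stands for [x^a y^(m - 2 -
    b)]. *)
Definition interpolant (al : node_pair -> R) (x y : R) : R :=
  \sum_(p : node_pair) al p * (x ^+ (val p).1 * y ^+ (q.*2.-1 - (val p).2)).

Let sum_degree (p : node_pair) :
  ((val p).1 + (q.*2.-1 - (val p).2) <= q.*2.-2)%N.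
Proof. by have := valP p; have := ltn_ord (val p).2; rewrite /=; lia. Qed.

(** The interpolant along the parametrization [t |-> (t^m, (1 - t)^m)] of the
    curve. *)
Let pullback (al : node_pair -> R) : {poly C} :=
  \sum_(p : node_pair) iota (al p) *: ('X^(m * (val p).1) * ((1 - 'X) ^+ (m * (q.*2.-1 - (val p).2)))).

Let size_pullback al : (size (pullback al) <= (m * q.*2.-2).+1)%N.
Proof.
apply: leq_trans (size_sum _ _ _) _; apply/bigmax_leqP => p _.
apply: leq_trans (size_scale_leq _ _) _.
apply: leq_trans (size_polyMleq _ _) _; rewrite size_polyXn /=.
have s1X : size (1 - 'X : {poly C}) = 2%N by rewrite -opprB size_polyN size_XsubC.
have := size_poly_exp_leq (1 - 'X : {poly C}) (m * (q.*2.-1 - (val p).2)).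
rewrite s1X mul1n => sX; apply: leq_trans (leq_add (leqnn _) sX) _.
by rewrite addnS ltnS -mulnDr leq_mul2l sum_degree orbT.
Qed.

Let pullback_node al a b u v : is_node a b u v ->
  (pullback al).[node_point a b] = iota (interpolant al (u ^+ m) (v ^+ m)).
Proof.
move=> [tu tv]; rewrite /pullback horner_sum rmorph_sum; apply: eq_bigr => p _.
rewrite hornerZ hornerM !horner_exp !hornerE/= !exprM tu tv.
by rewrite !rmorphM !rmorphXn.
Qed.

(** An interpolant that vanishes at all nodes has, along the parametrization,
    the [(m - 1)(m - 2)] parameters of the nodes as roots, two for each node.
    This exceeds its degree, at most [m (m - 3)], by 2. *)
Let pullback_eq0 al :
  (forall p, interpolant al (U p ^+ m) (V p ^+ m) = 0) -> pullback al = 0.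
Proof.
move=> al0.
pose D := [pred p : 'I_q.*2 * 'I_q.*2 | p.1 != p.2].
(* Node indices start at 1 and ordinals at 0; a decreasing pair is reflected to
   an increasing one by conjugation. *)
pose rs := map (fun p : 'I_q.*2 * 'I_q.*2 => node_point p.1.+1 p.2.+1) (enum D).
apply: (@roots_geq_poly_eq0 _ _ rs).
- apply/allP => _ /mapP[p pD ->]; move: pD; rewrite mem_enum inE => p12.
  have pI := node_pair_index p12; rewrite /root.
  have [lt12|lt21|/val_inj/eqP] := ltngtP p.1 p.2; last by rewrite (negbTE p12).
    pose p' : node_pair := Sub p lt12.
    by rewrite (pullback_node al (UV_node p')) al0 rmorph0.
  have rlt : (rev_ord p.1 < rev_ord p.2)%N.
    by have := ltn_ord p.1; move: lt21; rewrite /=; lia.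
  pose p' : node_pair := Sub (rev_ord p.1, rev_ord p.2) rlt.
  have := UV_node p'; rewrite /= => /is_node_conj.
  have rI : node_index (q.*2 - p.1.+1).+1 (q.*2 - p.2.+1).+1.
    by apply: (node_pair_index (p := (rev_ord p.1, rev_ord p.2))); rewrite (inj_eq rev_ord_inj).
  move=> /(_ rI).
  have -> : (m - (q.*2 - p.1.+1).+1 = p.1.+1)%N by have := ltn_ord p.1; lia.
  have -> : (m - (q.*2 - p.2.+1).+1 = p.2.+1)%N by have := ltn_ord p.2; lia.
  by move=> /(pullback_node al) ->; rewrite al0 rmorph0.
- rewrite map_inj_in_uniq ?enum_uniq// => p p'.
  rewrite !mem_enum !inE => /node_pair_index pI /node_pair_index pI'.
  move=> /(node_point_inj pI pI')[[e1] [e2]].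
  by move: p p' e1 e2 {pI pI'} => [a b] [a' b'] /= /val_inj -> /val_inj ->.
- apply: leq_trans (size_pullback al) _; rewrite size_map -cardE.
  pose diag := [pred p : 'I_q.*2 * 'I_q.*2 | p.1 == p.2].
  have diag_le : (#|diag| <= q.*2)%N.
    rewrite -[X in (_ <= X)%N]card_ord -(@card_in_image _ _ fst diag) ?max_card//.
    by move=> [a b] [a' b']; rewrite !inE/= => /eqP <- /eqP <- ->.
  have := cardC diag; rewrite card_prod !card_ord => cardD.
  have -> : #|D| = #|[predC diag]| by exact: eq_card.
  move: #|diag| #|predC diag| cardD diag_le => a b ab aq.
  have [n nE] : exists n, q.*2 = n.+2 by exists q.-1.*2; lia.
  by move: ab aq; rewrite nE; nia.
Qed.

(** There are as many monomials as nodes, so injectivity suffices. An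
    interpolant that vanishes at the nodes vanishes on the whole curve, and its
    degree is too small for that, by the independence of [X^m] and [(1 - X)^m]. *)
Lemma interpolation (s : node_pair -> R) :
  exists al, forall p, interpolant al (U p ^+ m) (V p ^+ m) = s p.
Proof.
pose N := #|{: node_pair}|.
pose mon (p p' : node_pair) := (U p' ^+ m) ^+ (val p).1 * (V p' ^+ m) ^+ (q.*2.-1 - (val p).2).
pose E : 'M[R]_N := \matrix_(i, j) mon (enum_val i) (enum_val j).
have sumE (x : 'rV[R]_N) j : (x *m E) 0 j =
    interpolant (fun p : node_pair => x 0 (enum_rank p)) (U (enum_val j) ^+ m) (V (enum_val j) ^+ m).
  rewrite mxE /interpolant [RHS](reindex (fun i : 'I_N => enum_val i))/=; last first.
    exact/onW_bij/enum_val_bij.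
  by apply: eq_bigr => i _; rewrite !mxE enum_valK.
have Eunit : E \in unitmx.
  rewrite -row_free_unit; apply: inj_row_free => x xE0.
  pose al (p : node_pair) := x 0 (enum_rank p).
  have /pullback_eq0 pb0 p : interpolant al (U p ^+ m) (V p ^+ m) = 0.
    by have := sumE x (enum_rank p); rewrite xE0 mxE enum_rankK => <-.
  (* Coefficient of [x^c] in the interpolant, as a polynomial in [y]. *)
  pose Q c : {poly C} := \sum_(p : node_pair | (val p).1 == c :> nat)
    iota (al p) *: 'X^(q.*2.-1 - (val p).2).
  have sQ c : (size (Q c) <= m)%N.
    apply: leq_trans (size_sum _ _ _) _; apply/bigmax_leqP => p _.
    apply: leq_trans (size_scale_leq _ _) _; rewrite size_polyXn.
    by have := ltn_ord (val p).2; lia.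
  have pbQ : pullback al = \sum_(c < q.*2) 'X^(m * c) * (Q c \Po (1 - 'X) ^+ m).
    rewrite /pullback (partition_big (fun p : node_pair => (val p).1) xpredT)//=.
    apply: eq_bigr => c _; rewrite /Q (raddf_sum (comp_poly ((1 - 'X) ^+ m))) mulr_sumr.
    apply: eq_big => [p|p /eqP <-]; first by rewrite -val_eqE.
    by rewrite /= comp_polyZ comp_Xn_poly -exprM -scalerAr.
  have mC : m%:R != 0 :> C by rewrite -(rmorph_nat iota) fmorph_eq0 pnatr_eq0.
  apply/rowP => i; rewrite mxE.
  have Qi : Q (val (enum_val i : node_pair)).1 = 0.
    by apply: (comp_sum_eq0 mC sQ _ (ltn_ord _)); rewrite -pbQ.
  apply: (fmorph_inj iota); rewrite rmorph0.
  have := congr1 (coefp (q.*2.-1 - (val (enum_val i : node_pair)).2)) Qi.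
  rewrite /= coef0 coef_sum (bigD1 (enum_val i))//= big1 ?addr0 => [|p].
    by rewrite coefZ coefXn eqxx mulr1 /al enum_valK.
  move=> /andP[/eqP p1 pi]; rewrite coefZ coefXn; case: eqP => [p2|_]; last by rewrite mulr0.
  case/eqP: pi; apply: val_inj.
  have e1 : (val p).1 = (val (enum_val i : node_pair)).1 by exact: val_inj.
  have e2 : (val p).2 = (val (enum_val i : node_pair)).2.
    apply: val_inj; have := ltn_ord (val p).2.
    have := ltn_ord (val (enum_val i : node_pair)).2; move: p2 => /=; lia.
  by rewrite [LHS]surjective_pairing [RHS]surjective_pairing e1 e2.
exists (fun p : node_pair => ((\row_j s (enum_val j)) *m invmx E) 0 (enum_rank p)) => p.
have := sumE ((\row_j s (enum_val j)) *m invmx E) (enum_rank p).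
by rewrite mulmxKV// mxE enum_rankK => <-.
Qed.

End Interpolation.

Lemma is_node_unique a b u v u' v' :
  is_node a b u v -> is_node a b u' v' -> u = u' /\ v = v'.
Proof.
move=> [tu tv] [tu' tv']; split; apply: (odd_pow_inj m_odd);
  by apply: (fmorph_inj iota); rewrite !rmorphXn -?tu -?tv.
Qed.

(** The sign condition says that each node is a strict local extremum of the
    norm form: a minimum above the arc [u + v = 1] and a maximum below it. *)
Lemma abstract_solitary_nodes : (0 < q)%N -> exists U V : node_pair -> R,
  [/\ forall p, [/\ U p != 0, U p + V p != 1
        & norm_form m 1 (U p ^+ m) (V p ^+ m) = 0],
      forall p p', U p = U p' -> V p = V p' -> p = p',
      forall u v, u != 0 -> u + v != 1 ->
        (forall p, u = U p -> v = V p -> False) ->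
        0 < norm_form m 1 (u ^+ m) (v ^+ m) * (u + v - 1)
    & forall s, exists al, forall p,
        interpolant al (U p ^+ m) (V p ^+ m) = s p].
Proof.
move=> q_gt0.
have pI (p : node_pair) : node_index (val p).1.+1 (val p).2.+1.
  by apply: node_pair_index; rewrite neq_ltn (valP p).
have /choice[U /choice[V UV]] (p : node_pair) := node_exists (pI p).
exists U, V; split.
- move=> p; split; first exact: node_u_neq0 (pI p) (UV p).
    exact: node_off_line (pI p) (UV p).
  exact: node_is_zero (pI p) (UV p).
- move=> p p' eU eV; have := UV p'; rewrite -eU -eV => n'.
  have [||[e1] [e2]] := node_inj (pI p) (pI p') _ _ (UV p) n'; rewrite ?ltnS ?(valP p) ?(valP p')//.
  apply: val_inj; rewrite [LHS]surjective_pairing [RHS]surjective_pairing.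
  by congr (_, _); exact: val_inj.
- move=> u v u0 uv notnode; have [P [P0 -> Pz]] := norm_form_sign v u0.
  have Ppos : 0 < P.
    rewrite lt_def P0 andbT; apply/eqP => /Pz[r rm] /(zero_is_node u0 rm).
    move=> [a [b [ab ltab nab]]]; have /and3P[/andP[a0 am] /andP[b0 bm] _] := ab.
    have am' : (a.-1 < q.*2)%N by rewrite -ltnS prednK.
    have bm' : (b.-1 < q.*2)%N by rewrite -ltnS prednK.
    have ltab' : (Ordinal am' < Ordinal bm')%N by rewrite /= -ltnS !prednK.
    pose p : node_pair := Sub (Ordinal am', Ordinal bm') ltab'.
    have := UV p; rewrite /= !prednK// => n'.
    have [eU eV] := is_node_unique nab n'.
    exact: (notnode p).
  rewrite mulrAC pmulr_lgt0//.
  have [lt1|lt1|e1] := ltgtP (1 - u) v; last first.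
    by move: uv; rewrite -e1 addrC subrK eqxx.
    have : v ^+ m < (1 - u) ^+ m by have /= -> := ltr_odd_pow m_odd v (1 - u).
    by rewrite -subr_lt0 => pw; rewrite nmulr_rgt0//; lra.
  have : (1 - u) ^+ m < v ^+ m by have /= -> := ltr_odd_pow m_odd (1 - u) v.
  by rewrite -subr_gt0 => pw; rewrite pmulr_rgt0//; lra.
- exact: interpolation.
Qed.

End ConjugateNodes.

Lemma solitary_nodes (R : rcfType) (q : nat) : (0 < q)%N ->
  exists U V : {p : 'I_q.*2 * 'I_q.*2 | (p.1 < p.2)%N} -> R,
  [/\ forall p, [/\ U p != 0, U p + V p != 1
        & norm_form q.*2.+1 1 (U p ^+ q.*2.+1) (V p ^+ q.*2.+1) = 0],
      forall p p', U p = U p' -> V p = V p' -> p = p',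
      forall u v, u != 0 -> u + v != 1 ->
        (forall p, u = U p -> v = V p -> False) ->
        0 < norm_form q.*2.+1 1 (u ^+ q.*2.+1) (v ^+ q.*2.+1) * (u + v - 1)
    & forall s, exists al : {p : 'I_q.*2 * 'I_q.*2 | (p.1 < p.2)%N} -> R, forall p,
        interpolant al (U p ^+ q.*2.+1) (V p ^+ q.*2.+1) = s p].
Proof.
move=> q_gt0.
have mC : (q.*2.+1)%:R != 0 :> R[i] by rewrite pnatr_eq0.
have [w w_prim] := primitive_root_exists mC.
apply: (@abstract_solitary_nodes R R[i] (real_complex R) (@conjc R) _ _ _ _ q w) => //.
- exact: conjcK.
- exact: conjc_real.
- move=> [a b] /= [ba]; exists a; congr (_ +i* _)%C; lra.
- move=> [a b]; exists (a ^+ 2 + b ^+ 2); split.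
  + by rewrite addr_ge0 ?sqr_ge0.
  + by apply/eqP; rewrite eq_complex /=; apply/andP; split; apply/eqP; ring.
  + move/eqP; rewrite paddr_eq0 ?sqr_ge0// !sqrf_eq0.
    by move=> /andP[/eqP -> /eqP ->].
Qed.

(** * Chebyshev polynomials *)

(** The recursion is homogenized by [a], so that one definition gives both the
    form and, at [a = 1], the polynomial. *)
Fixpoint chebyshev (A : comNzRingType) (a x : A) (k : nat) : A :=
  match k with
  | 0 => 1
  | 1 => x
  | (k'.+1 as k1).+1 => 2%:R * x * chebyshev a x k1 - a ^+ 2 * chebyshev a x k'
  end.

Lemma chebyshev_ind (Q : nat -> Prop) :
  Q 0%N -> Q 1%N -> (forall k, Q k -> Q k.+1 -> Q k.+2) -> forall k, Q k.
Proof.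
move=> Q0 Q1 QS k; suff [] : Q k /\ Q k.+1 by [].
by elim: k => [|k [IH IH1]]; split=> //; exact: QS.
Qed.

Lemma chebyshev_rmorph (A B : comNzRingType) (g : {rmorphism A -> B}) a x k :
  g (chebyshev a x k) = chebyshev (g a) (g x) k.
Proof.
elim/chebyshev_ind: k => [|//|k IH IH1]; first exact: rmorph1.
have -> : chebyshev a x k.+2 = 2%:R * x * chebyshev a x k.+1 - a ^+ 2 * chebyshev a x k.
  by [].
by rewrite rmorphB !rmorphM rmorph_nat IH IH1.
Qed.

Lemma dhomog_chebyshev (A : comNzRingType) (n : nat) (a x : mpoly n A) k :
  a \is ishomog1 1 mdeg -> x \is ishomog1 1 mdeg ->
  chebyshev a x k \is ishomog1 k mdeg.
Proof.
move=> a1 x1; elim/chebyshev_ind: k => [|//|k IH IH1]; first exact: dhomog1.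
have -> : chebyshev a x k.+2 =
    (x * chebyshev a x k.+1) *+ 2 - a ^+ 2 * chebyshev a x k.
  by rewrite /= -mulrA mulr_natl.
apply: rpredB.
  by rewrite rpredMn// -[k.+2]add1n; apply: dhomogM.
rewrite -[k.+2]add2n; apply: dhomogM => //.
by have := dhomogMn 2 a1; rewrite mul1n.
Qed.

Section ChebyshevReal.
Variable R : realType.

Lemma chebyshev_cos (x : R) k : chebyshev 1 (cos x) k = cos (x *+ k).
Proof.
elim/chebyshev_ind: k => [||k IH IH1]; rewrite ?mulr0n ?cos0 ?mulr1n//.
have -> : chebyshev 1 (cos x) k.+2 =
  2%:R * cos x * chebyshev 1 (cos x) k.+1 - 1 ^+ 2 * chebyshev 1 (cos x) k by [].
rewrite IH IH1 expr1n mul1r.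
have -> : x *+ k.+2 = x *+ k.+1 + x by rewrite mulrSr.
have -> : x *+ k = x *+ k.+1 - x by rewrite mulrSr addrK.
by rewrite cosB cosD; ring.
Qed.

Variable m : nat.
Hypothesis m_gt0 : (0 < m)%N.

(** The abscissas where the Chebyshev polynomial of degree [m] takes the value
    1, 0 or -1: extrema for even [j], zeros for odd [j]. *)
Definition chebyshev_node (j : nat) : R := cos (j%:R * (@pi R / (m.*2)%:R)).

Let m2_gt0 : 0 < (m.*2)%:R :> R. Proof. by rewrite ltr0n double_gt0. Qed.

Lemma chebyshev_node_decr i j : (i < j)%N -> (j <= m.*2)%N ->
  chebyshev_node j < chebyshev_node i.
Proof.
move=> ij jm; have p0 := pi_gt0 R.
have d0 : 0 < @pi R / (m.*2)%:R by rewrite divr_gt0.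
have le_pi k : (k <= m.*2)%N -> 0 <= k%:R * (@pi R / (m.*2)%:R) <= @pi R.
  move=> km; apply/andP; split; first by apply: mulr_ge0; [exact: ler0n|exact: (ltW d0)].
  by rewrite mulrA ler_pdivrMr// mulrC ler_pM2l// ler_nat.
rewrite /chebyshev_node ltr_cos ?in_itv/= ?le_pi//; last exact: leq_trans (ltnW ij) jm.
by rewrite ltr_pM2r// ltr_nat.
Qed.

Lemma chebyshev_at_node j : chebyshev 1 (chebyshev_node j) m = cos (j%:R * (@pi R / 2)).
Proof.
have m0 : m%:R != 0 :> R by rewrite pnatr_eq0 -lt0n.
rewrite chebyshev_cos; congr cos.
by rewrite -mulr_natr -muln2 natrM; field.
Qed.

Lemma cos_nat_pi k : cos (k%:R * @pi R) = (-1) ^+ k.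
Proof.
elim: k => [|k IH]; first by rewrite mul0r cos0.
by rewrite -natr1 mulrDl mul1r cosDpi IH exprS mulN1r.
Qed.

Lemma chebyshev_node_even k : chebyshev 1 (chebyshev_node k.*2) m = (-1) ^+ k.
Proof.
by rewrite chebyshev_at_node -cos_nat_pi -muln2 natrM -mulrA [2%:R * _]mulrC divfK.
Qed.

Lemma chebyshev_node_odd k : chebyshev 1 (chebyshev_node k.*2.+1) m = 0.
Proof.
rewrite chebyshev_at_node (_ : _ * _ = k%:R * @pi R + @pi R / 2); last first.
  by rewrite -natr1 -muln2 natrM; field.
rewrite cosDpihalf cos1sin0 ?oppr0// cos_nat_pi.
by rewrite normrX normrN1 expr1n.
Qed.

Lemma chebyshev_bounded (x : R) : -1 <= x <= 1 -> `|chebyshev 1 x m| <= 1.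
Proof.
move=> x1; rewrite -(acosK x1) chebyshev_cos; exact: cos_max.
Qed.

End ChebyshevReal.

(** * Wells *)

Section Wells.
Variables (R : realType) (J q : nat).
Hypothesis q_gt0 : (0 < q)%N.
Local Notation m := q.*2.+1.
Local Notation node_pair := {p : 'I_q.*2 * 'I_q.*2 | (p.1 < p.2)%N}.
Local Notation pt := 'rV[R]_J.+2.

Let m_odd : odd m. Proof. by rewrite /= odd_double. Qed.

Definition kx : 'I_J.+2 := ord0.
Definition ky : 'I_J.+2 := fintype.lift ord0 ord0.
Definition kz (j : 'I_J) : 'I_J.+2 := fintype.lift ord0 (fintype.lift ord0 j).

Variant coordinate_spec : 'I_J.+2 -> Type :=
| CoordinateX : coordinate_spec kx
| CoordinateY : coordinate_spec ky
| CoordinateZ j : coordinate_spec (kz j).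

Lemma coordinateP k : coordinate_spec k.
Proof.
case: (unliftP ord0 k) => [k' ->|->]; last exact: CoordinateX.
case: (unliftP ord0 k') => [j ->|->]; [exact: CoordinateZ|exact: CoordinateY].
Qed.

Definition coordinates (T : Type) (x y : T) (z : 'I_J -> T) (k : 'I_J.+2) : T :=
  if unlift ord0 k is Some k' then
    if unlift ord0 k' is Some j then z j else y
  else x.

Lemma coordinatesE (T : Type) (x y : T) (z : 'I_J -> T) :
  [/\ coordinates x y z kx = x, coordinates x y z ky = y
    & forall j, coordinates x y z (kz j) = z j].
Proof.
by split=> [||j]; rewrite /coordinates ?unlift_none ?liftK// ?unlift_none// liftK.
Qed.

Definition var (l : 'I_J.+3) : mpoly J.+3 R := mpolyX R (mnm1 l).
Definition var0 := var ord0.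
Definition vark (k : 'I_J.+2) := var (fintype.lift ord0 k).

Lemma dhomog_var l : var l \is ishomog1 1 mdeg.
Proof. by rewrite dhomogX; apply/eqP; exact: mdeg1. Qed.

Lemma value_var (P : pt) : value var0 (chart_point P) = 1 /\
  forall k, value (vark k) (chart_point P) = P 0 k.
Proof.
by rewrite /value; split=> [|k]; rewrite mevalXU mxE ?unlift_none ?liftK.
Qed.

Definition plane_part : mpoly J.+3 R := norm_form m var0 (vark kx) (vark ky).

Definition interpolation_part (al : node_pair -> R) : mpoly J.+3 R :=
  \sum_(p : node_pair) al p *:
    (vark kx ^+ (val p).1 * vark ky ^+ (q.*2.-1 - (val p).2) *
     var0 ^+ (m - ((val p).1 + (q.*2.-1 - (val p).2)))).

Definition chebyshev_part : mpoly J.+3 R :=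
  \sum_(j < J) chebyshev var0 (vark (kz j)) m.

(** A small multiple of the second term perturbs a form that vanishes at all the
    nodes, whatever the other coordinates. *)
Definition well_form (al : node_pair -> R) (d : R) : mpoly J.+3 R :=
  plane_part + d *: (interpolation_part al + chebyshev_part).

Lemma dhomog_well_form al d : well_form al d \is ishomog1 m mdeg.
Proof.
apply: rpredD; first by apply: dhomog_norm_form; exact: dhomog_var.
apply: rpredZ; apply: rpredD; last first.
  by apply: rpred_sum => j _; apply: dhomog_chebyshev; exact: dhomog_var.
apply: rpred_sum => p _; apply: rpredZ; set a := nat_of_ord _; set b := (_ - _)%N.
have abm : (a + b <= m)%N.
  by rewrite /a /b; have := valP p; have := ltn_ord (val p).2; rewrite /=; lia.
rewrite -{2}(subnKC abm); apply: dhomogM; [apply: dhomogM|].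
- by have := dhomogMn a (dhomog_var (fintype.lift ord0 kx)); rewrite mul1n.
- by have := dhomogMn b (dhomog_var (fintype.lift ord0 ky)); rewrite mul1n.
- by have := dhomogMn (m - (a + b)) (dhomog_var ord0); rewrite mul1n.
Qed.

Definition plane_value (P : pt) : R := norm_form m 1 (P 0 kx) (P 0 ky).

Definition perturbation_value (al : node_pair -> R) (P : pt) : R :=
  interpolant al (P 0 kx) (P 0 ky) + \sum_(j < J) chebyshev 1 (P 0 (kz j)) m.

Lemma value_parts al (P : pt) :
  value plane_part (chart_point P) = plane_value P /\
  value (interpolation_part al + chebyshev_part) (chart_point P) =
    perturbation_value al P.
Proof.
have [v0 vk] := value_var P; split.
  rewrite /plane_value -!vk -v0.
  exact: (norm_form_rmorph m (meval (chart_point P 0))).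
have valueD f g : value (f + g) (chart_point P) =
    value f (chart_point P) + value g (chart_point P) by exact: mevalD.
rewrite valueD /perturbation_value; congr (_ + _).
  rewrite /value /interpolation_part raddf_sum/=.
  apply: eq_bigr => p _; rewrite mevalZ; congr (_ * _).
  rewrite !mevalM !rmorphXn/= [meval _ var0]v0 [meval _ (vark kx)]vk.
  by rewrite [meval _ (vark ky)]vk expr1n mulr1.
rewrite /value /chebyshev_part raddf_sum/=.
apply: eq_bigr => j _.
have -> := chebyshev_rmorph (meval (chart_point P 0)) var0 (vark (kz j)) m.
by rewrite /= [meval _ var0]v0 [meval _ (vark (kz j))]vk.
Qed.

Lemma value_well_form al d (P : pt) : value (well_form al d) (chart_point P) =
  plane_value P + d * perturbation_value al P.
Proof.
have [<- <-] := value_parts al P.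
by rewrite /well_form /value mevalD mevalZ.
Qed.

Lemma odd_root_between (a b x : R) : a ^+ m <= x <= b ^+ m ->
  exists2 u, a <= u <= b & u ^+ m = x.
Proof.
move=> /andP[ax xb]; have [u ux] := odd_root m_odd x; exists u => //.
have mono (s t : R) : (s ^+ m < t ^+ m) = (s < t) := ltr_odd_pow m_odd s t.
by apply/andP; split; rewrite leNgt -mono ux -leNgt.
Qed.

Variables U V : node_pair -> R.
Hypothesis UV_node : forall p, [/\ U p != 0, U p + V p != 1
  & norm_form m 1 (U p ^+ m) (V p ^+ m) = 0].
Hypothesis UV_inj : forall p p', U p = U p' -> V p = V p' -> p = p'.
Hypothesis UV_sign : forall u v, u != 0 -> u + v != 1 ->
  (forall p, u = U p -> v = V p -> False) ->
  0 < norm_form m 1 (u ^+ m) (v ^+ m) * (u + v - 1).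

(** The side of the arc: [sigma] is 1 at the nodes that are minima of the norm
    form and -1 at those that are maxima. All later inequalities are multiplied
    by [sigma], which treats the two cases at once. *)
Definition below (p : node_pair) : bool := U p + V p < 1.
Definition sigma (p : node_pair) : R := (-1) ^+ below p.

Variable al : node_pair -> R.
Hypothesis al_node : forall p,
  interpolant al (U p ^+ m) (V p ^+ m) = sigma p * (J%:R - 2^-1).

Lemma sigma_sqr p : sigma p * sigma p = 1.
Proof. by rewrite -expr2 sqrr_sign. Qed.

Lemma sigma_node p : 0 < sigma p * (U p + V p - 1).
Proof.
have [_ uv _] := UV_node p; rewrite /sigma /below.
by have [lt1|gt1|e1] := ltgtP (U p + V p) 1;
  [rewrite mulN1r; lra|rewrite mul1r; lra|rewrite e1 eqxx in uv].
Qed.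

Lemma interpolant_continuous :
  continuous (fun w : R * R => interpolant al (w.1 ^+ m) (w.2 ^+ m)).
Proof.
move=> w.
have cX (g : R * R -> R) (k : nat) : {for w, continuous g} ->
    {for w, continuous (fun x => g x ^+ k)}.
  move=> cg; apply: (@continuous_comp _ _ _ g (fun y => y ^+ k)) => //.
  exact: exprn_continuous.
have cf : {for w, continuous (fun x : R * R => x.1)} by exact: cvg_fst.
have cs : {for w, continuous (fun x : R * R => x.2)} by exact: cvg_snd.
rewrite /interpolant; elim: (index_enum _) => [|p s IH].
  by under eq_fun do rewrite big_nil; exact: cvg_cst.
under eq_fun do rewrite big_cons.
apply: continuousD IH; apply: continuousM; first exact: cvg_cst.
by apply: continuousM; apply: (cX); apply: (cX).
Qed.

(** Squares in the coordinates [u] and [v]; taking [m]-th powers turns them into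
    rectangles of the plane of the curve. *)
Definition close (r : R) (p : node_pair) (u v : R) : Prop :=
  `|u - U p| <= r /\ `|v - V p| <= r.

(** What is needed of the points near a node: they stay off the arc and away
    from the other nodes, and the interpolant, equal to [J - 1/2] at the node up
    to sign, still exceeds [J - 1]. *)
Definition good (p : node_pair) (u v : R) : Prop :=
  [/\ u != 0, 0 < sigma p * (u + v - 1),
      forall p', u = U p' -> v = V p' -> p' = p
    & J%:R - 1 < sigma p * interpolant al (u ^+ m) (v ^+ m)].

Lemma near_neq (T : topologicalType) (g : T -> R) (t : T) (b : R) :
  {for t, continuous g} -> g t != b -> \forall s \near t, g s != b.
Proof.
move=> cg gb; have cgb : (fun s => g s - b) @ t --> g t - b.
  by apply: cvgB; [exact: cg|exact: cvg_cst].
have gb0 : g t - b != 0 by rewrite subr_eq0.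
have nz : \forall s \near t, g s - b != 0 by apply: (cvgr_neq0 _ cgb).
by apply: filterS nz => s; rewrite subr_eq0.
Qed.

Lemma good_near p : \forall w \near (U p, V p), good p w.1 w.2.
Proof.
have [u0 uv _] := UV_node p.
have nz : \forall w \near (U p, V p), w.1 != 0 :> R.
  have cf : fst @ (U p, V p) --> U p by exact: cvg_fst.
  exact: (near_neq cf u0).
have side : \forall w \near (U p, V p), 0 < sigma p * (w.1 + w.2 - 1) :> R.
  have cs : (fun w : R * R => sigma p * (w.1 + w.2 - 1)) @ (U p, V p) -->
      sigma p * (U p + V p - 1).
    apply: cvgM; first exact: cvg_cst.
    by apply: cvgB; [apply: cvgD; [exact: cvg_fst|exact: cvg_snd]|exact: cvg_cst].
  exact: (cvgr_gt _ cs _ (sigma_node p)).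
have interp : \forall w \near (U p, V p),
    J%:R - 1 < sigma p * interpolant al (w.1 ^+ m) (w.2 ^+ m).
  have ci := @interpolant_continuous (U p, V p).
  have cs : (fun w : R * R => sigma p * interpolant al (w.1 ^+ m) (w.2 ^+ m)) @
      nbhs (U p, V p) --> sigma p * interpolant al (U p ^+ m) (V p ^+ m).
    exact: (cvgM (cvg_cst (sigma p)) ci).
  apply: (cvgr_gt _ cs); rewrite al_node mulrA sigma_sqr mul1r; lra.
have others : \forall w \near (U p, V p), forall p', w.1 = U p' -> w.2 = V p' -> p' = p.
  apply: (@filter_forall _ _ _ _ (nbhs_filter (U p, V p))) => p'.
  have [->|p'p] := eqVneq p' p; first exact: nearW.
  have : (U p != U p') || (V p != V p').
    rewrite -negb_and; apply: contra p'p => /andP[/eqP eU /eqP eV].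
    by apply/eqP/esym/UV_inj.
  case/orP => neq.
    have cf : fst @ (U p, V p) --> U p by exact: cvg_fst.
    apply: filterS (near_neq cf neq) => w wU /eqP; by rewrite (negbTE wU).
  have cf : snd @ (U p, V p) --> V p by exact: cvg_snd.
  by apply: filterS (near_neq cf neq) => w wV _ /eqP; rewrite (negbTE wV).
by apply: filterS2 (filterI nz side) (filterI interp others) => w [? ?] [? ?].
Qed.

(** Take less than a third of the good radius of each of the finitely many
    nodes. Two squares cannot meet, since each node is the only one in its good
    neighbourhood. *)
Lemma radius_exists : exists r : R, [/\ 0 < r,
    forall p u v, close r p u v -> good p u v
  & forall p p' u v, close r p u v -> close r p' u v -> p = p'].
Proof.
have /choice[e eP] p : exists e : R, 0 < e /\
    forall u v, `|u - U p| < e -> `|v - V p| < e -> good p u v.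
  have /nbhs_ballP[e /= e0 eg] := good_near p; exists e; split=> // u v ue ve.
  by apply: (eg (u, v)); split; rewrite /ball/= distrC.
have small : \forall r \near 0^'+, 0 < r /\ forall p, r < e p / 3.
  apply: filterI; first exact: nbhs_right_gt.
  apply: (@filter_forall _ _ _ (0^'+) _) => p.
  by apply: nbhs_right_lt; rewrite divr_gt0//; have [] := eP p.
have [r [r0 re]] := filter_ex small; exists r; split=> // [p u v [ur vr]|p p' u v].
  have [_ gp] := eP p; apply: gp; have := re p; lra.
move=> [up vp] [up' vp']; have [_ gp] := eP p.
have close_nodes (a b c : R) : `|c - a| <= r -> `|c - b| <= r -> `|b - a| < e p.
  move=> ca cb; have := re p; rewrite -(subrK c b) -addrA.
  by have := ler_normD (b - c) (c - a); rewrite (distrC b c); lra.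
have [_ _ oth _] := gp (U p') (V p') (close_nodes _ _ _ up up') (close_nodes _ _ _ vp vp').
by rewrite (oth p').
Qed.

Variable r : R.
Hypothesis r_gt0 : 0 < r.
Hypothesis r_good : forall p u v, close r p u v -> good p u v.
Hypothesis r_sep : forall p p' u v, close r p u v -> close r p' u v -> p = p'.

Lemma plane_sign p u v : close r p u v ->
  0 <= sigma p * norm_form m 1 (u ^+ m) (v ^+ m) /\
  (u != U p \/ v != V p -> 0 < sigma p * norm_form m 1 (u ^+ m) (v ^+ m)).
Proof.
move=> /r_good[u0 side oth _].
have uv1 : u + v != 1.
  by apply: contraTneq side => ->; rewrite subrr mulr0 ltxx.
have pos : u != U p \/ v != V p -> 0 < sigma p * norm_form m 1 (u ^+ m) (v ^+ m).
  move=> neq; have : 0 < norm_form m 1 (u ^+ m) (v ^+ m) * (u + v - 1).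
    apply: UV_sign => // p' uE vE; have p'p := oth p' uE vE.
    by case: neq; rewrite ?uE ?vE p'p eqxx.
  move: (sigma_sqr p) side; set s := sigma p; set g := norm_form _ _ _ _; set t := u + v - 1.
  move=> s1 st gt.
  have : 0 < (s * t) * (g * t) by rewrite mulr_gt0.
  have -> : (s * t) * (g * t) = (s * g) * (t * t) by ring.
  by rewrite pmulr_lgt0// -expr2 exprn_even_gt0//= (contraTneq _ gt)// => ->; rewrite mulr0 ltxx.
split=> //; have [uE|uE] := eqVneq u (U p); last by apply/ltW/pos; left.
have [vE|vE] := eqVneq v (V p); last by apply/ltW/pos; right.
by have [_ _ g0] := UV_node p; rewrite uE vE g0 mulr0.
Qed.

(** The index of an interior extremum of the Chebyshev polynomial, a minimum if
    [sigma] is 1 and a maximum if it is -1; there are [q] of each kind. *)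
Definition slot (p : node_pair) (ka : 'I_J -> 'I_q) (j : 'I_J) : nat :=
  (ka j).*2.+1 + below p.

Lemma slot_bounds p ka j : (0 < slot p ka j < m)%N.
Proof. by rewrite /slot; have := ltn_ord (ka j); case: (below p) => /=; lia. Qed.

(** Around a node in the plane, and between the two zeros of the Chebyshev
    polynomial around the chosen extremum in each of the other coordinates. *)
Definition box_lo p ka : 'I_J.+2 -> R :=
  coordinates ((U p - r) ^+ m) ((V p - r) ^+ m)
    (fun j => chebyshev_node R m (slot p ka j).*2.+1).
Definition box_hi p ka : 'I_J.+2 -> R :=
  coordinates ((U p + r) ^+ m) ((V p + r) ^+ m)
    (fun j => chebyshev_node R m (slot p ka j).*2.-1).
Definition box_center p ka : pt :=
  \row_k coordinates (U p ^+ m) (V p ^+ m)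
    (fun j => chebyshev_node R m (slot p ka j).*2) k.

Lemma box_center_in p ka : in_open_box (box_lo p ka) (box_hi p ka) (box_center p ka).
Proof.
have mono (s t : R) : s < t -> s ^+ m < t ^+ m.
  by have /= -> := ltr_odd_pow m_odd s t.
have [l0 l1 lz] := coordinatesE ((U p - r) ^+ m) ((V p - r) ^+ m)
  (fun j => chebyshev_node R m (slot p ka j).*2.+1).
have [h0 h1 hz] := coordinatesE ((U p + r) ^+ m) ((V p + r) ^+ m)
  (fun j => chebyshev_node R m (slot p ka j).*2.-1).
have [c0 c1 cz] := coordinatesE (U p ^+ m) (V p ^+ m)
  (fun j => chebyshev_node R m (slot p ka j).*2).
move=> k; rewrite mxE /box_lo /box_hi; case: (coordinateP k) => [||j].
- by rewrite l0 h0 c0; apply/andP; split; apply: mono; move: r_gt0; lra.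
- by rewrite l1 h1 c1; apply/andP; split; apply: mono; move: r_gt0; lra.
- rewrite lz hz cz; have /andP[s0 sm] := slot_bounds p ka j.
  by apply/andP; split; apply: chebyshev_node_decr; lia.
Qed.

Lemma box_point p ka (P : pt) : in_box (box_lo p ka) (box_hi p ka) P ->
  exists u v, [/\ close r p u v, P 0 kx = u ^+ m, P 0 ky = v ^+ m
    & forall j, `|chebyshev 1 (P 0 (kz j)) m| <= 1].
Proof.
have [l0 l1 lz] := coordinatesE ((U p - r) ^+ m) ((V p - r) ^+ m)
  (fun j => chebyshev_node R m (slot p ka j).*2.+1).
have [h0 h1 hz] := coordinatesE ((U p + r) ^+ m) ((V p + r) ^+ m)
  (fun j => chebyshev_node R m (slot p ka j).*2.-1).
move=> PB.
have := PB kx; rewrite /box_lo /box_hi l0 h0 => /odd_root_between[u ur uE].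
have := PB ky; rewrite /box_lo /box_hi l1 h1 => /odd_root_between[v vr vE].
exists u, v; split=> //; first by split; rewrite ler_norml; lra.
move=> j; apply: chebyshev_bounded.
have := PB (kz j); rewrite /box_lo /box_hi lz hz => /andP[zl zh].
by rewrite (le_trans (cos_geN1 _) zl) (le_trans zh (cos_le1 _)).
Qed.

(** Squares of distinct nodes are disjoint. Over one node, the chosen extrema
    are of the same kind, so distinct ones are separated by a zero of the
    Chebyshev polynomial. *)
Lemma in_box_inj p ka p' ka' (P : pt) :
  in_open_box (box_lo p ka) (box_hi p ka) P ->
  in_open_box (box_lo p' ka') (box_hi p' ka') P -> p = p' /\ ka =1 ka'.
Proof.
have weak q0 k0 : in_open_box (box_lo q0 k0) (box_hi q0 k0) P ->
    in_box (box_lo q0 k0) (box_hi q0 k0) P.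
  by move=> PB k; have /andP[/ltW-> /ltW->] := PB k.
move=> PB PB'.
have [u [v [cp Pu Pv _]]] := box_point (weak _ _ PB).
have [u' [v' [cp' Pu' Pv' _]]] := box_point (weak _ _ PB').
have uu : u = u' by apply: (odd_pow_inj m_odd); rewrite /= -Pu.
have vv : v = v' by apply: (odd_pow_inj m_odd); rewrite /= -Pv.
have pp : p = p' by apply: (r_sep cp); rewrite uu vv.
split=> // j; rewrite -pp in PB'.
have [_ _ lz] := coordinatesE ((U p - r) ^+ m) ((V p - r) ^+ m)
  (fun j => chebyshev_node R m (slot p ka j).*2.+1).
have [_ _ hz] := coordinatesE ((U p + r) ^+ m) ((V p + r) ^+ m)
  (fun j => chebyshev_node R m (slot p ka j).*2.-1).
have [_ _ lz'] := coordinatesE ((U p - r) ^+ m) ((V p - r) ^+ m)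
  (fun j => chebyshev_node R m (slot p ka' j).*2.+1).
have [_ _ hz'] := coordinatesE ((U p + r) ^+ m) ((V p + r) ^+ m)
  (fun j => chebyshev_node R m (slot p ka' j).*2.-1).
have := PB (kz j); have := PB' (kz j).
rewrite /box_lo /box_hi lz hz lz' hz' => /andP[zl' zh'] /andP[zl zh].
have sep a b : (0 < a)%N -> (b < m)%N -> (a.+1 < b)%N ->
    chebyshev_node R m b.*2.-1 < chebyshev_node R m a.*2.+1.
  by move=> a0 bm ab; apply: chebyshev_node_decr; lia.
have /andP[s0 sm] := slot_bounds p ka j; have /andP[s0' sm'] := slot_bounds p ka' j.
have [lt|lt|/val_inj//] := ltngtP (ka j) (ka' j).
  have := sep _ _ s0 sm'; rewrite {1}/slot => /(_ _) h.
  have {}h : chebyshev_node R m (slot p ka' j).*2.-1 < chebyshev_node R m (slot p ka j).*2.+1.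
    by apply: h; rewrite /slot; lia.
  by have := lt_trans (lt_trans zl zh') h; rewrite ltxx.
have h : chebyshev_node R m (slot p ka j).*2.-1 < chebyshev_node R m (slot p ka' j).*2.+1.
  by apply: sep => //; rewrite /slot; lia.
by have := lt_trans (lt_trans zl' zh) h; rewrite ltxx.
Qed.

Definition planar_edge p ka (P : pt) : Prop :=
  [\/ P 0 kx = box_lo p ka kx, P 0 kx = box_hi p ka kx,
      P 0 ky = box_lo p ka ky | P 0 ky = box_hi p ka ky].

(** On these faces the norm form does not vanish, and compactness leaves room
    for the perturbation. *)
Lemma planar_edge_near p ka : \forall d \near (0 : R), forall P : pt,
  in_box (box_lo p ka) (box_hi p ka) P -> planar_edge p ka P ->
  0 < sigma p * value (well_form al d) (chart_point P).
Proof.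
pose H (x : pt * R) := sigma p * (value plane_part (chart_point x.1) +
  x.2 * value (interpolation_part al + chebyshev_part) (chart_point x.1)).
have cH : continuous H.
  have cv (h : mpoly J.+3 R) : continuous (fun x : pt * R => value h (chart_point x.1)).
    move=> x; apply: continuous_comp; last exact: value_continuous.
    by apply: continuous_comp; [exact: cvg_fst|exact: chart_point_continuous].
  move=> x; apply: cvgM; first exact: cvg_cst.
  by apply: cvgD; [exact: cv|apply: cvgM; [exact: cvg_snd|exact: cv]].
pose K := [set P : pt | in_box (box_lo p ka) (box_hi p ka) P] `&`
  [set P : pt | planar_edge p ka P].
have cptK : compact K.
  apply: compact_closedI; first exact: box_compact.
  have cl (k : 'I_J.+2) (a : R) : closed [set P : pt | P 0 k = a].
    apply: (@preimage_closed _ _ (fun P : pt => P 0 k) [set a]) => //.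
    by move=> P _; exact: coord_continuous.
  have -> : [set P : pt | planar_edge p ka P] =
      ([set P : pt | P 0 kx = box_lo p ka kx] `|` [set P : pt | P 0 kx = box_hi p ka kx]) `|`
      ([set P : pt | P 0 ky = box_lo p ka ky] `|` [set P : pt | P 0 ky = box_hi p ka ky]).
    apply/seteqP; split=> P /=.
      by case=> e; [left; left|left; right|right; left|right; right].
    by case=> -[e|e]; [apply: Or41|apply: Or42|apply: Or43|apply: Or44].
  by apply: closedU; apply: closedU; exact: cl.
have pos P : K P -> 0 < H (P, 0).
  move=> [PB edge]; have [u [v [cp Pu Pv _]]] := box_point PB.
  have [vp _] := value_parts al P.
  rewrite /H /= mul0r addr0 vp /plane_value Pu Pv.
  have [_] := plane_sign cp; apply.
  have [l0 l1 _] := coordinatesE ((U p - r) ^+ m) ((V p - r) ^+ m)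
    (fun j => chebyshev_node R m (slot p ka j).*2.+1).
  have [h0 h1 _] := coordinatesE ((U p + r) ^+ m) ((V p + r) ^+ m)
    (fun j => chebyshev_node R m (slot p ka j).*2.-1).
  move: edge; rewrite /planar_edge /box_lo /box_hi l0 l1 h0 h1 /= Pu Pv.
  case=> /(odd_pow_inj m_odd) ->; [left|left|right|right];
    apply/eqP => e; move: r_gt0; lra.
have := positive_near cptK cH pos.
apply: filterS => d dP P PB edge.
have [vp vq] := value_parts al P.
by have := dP P (conj PB edge); rewrite /H/= vp vq value_well_form.
Qed.

(** At the centre the norm form vanishes and each Chebyshev term is [- sigma],
    so that the perturbation has the sign of [(J - 1/2) - J < 0]. On a face in a
    direction [z_j] the term of index [j] vanishes, and the interpolant, larger
    than [J - 1], outweighs the [J - 1] others, each at most 1. On the other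
    faces the norm form dominates. *)
Lemma well_isolating p ka d : 0 < d ->
  (forall P : pt, in_box (box_lo p ka) (box_hi p ka) P -> planar_edge p ka P ->
     0 < sigma p * value (well_form al d) (chart_point P)) ->
  isolating_box (well_form al d) (box_lo p ka) (box_hi p ka).
Proof.
move=> d0 edge_pos.
have valueE P : sigma p * value (well_form al d) (chart_point P) =
    sigma p * plane_value P + d * (sigma p * perturbation_value al P).
  by rewrite value_well_form; ring.
have [l0 l1 lz] := coordinatesE ((U p - r) ^+ m) ((V p - r) ^+ m)
  (fun j => chebyshev_node R m (slot p ka j).*2.+1).
have [h0 h1 hz] := coordinatesE ((U p + r) ^+ m) ((V p + r) ^+ m)
  (fun j => chebyshev_node R m (slot p ka j).*2.-1).
have s_abs x : `|sigma p * x| = `|x|.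
  by rewrite /sigma normrM normr_sign mul1r.
have edge_sign P : in_box (box_lo p ka) (box_hi p ka) P ->
    ~ in_open_box (box_lo p ka) (box_hi p ka) P ->
    0 < sigma p * value (well_form al d) (chart_point P).
  move=> PB /existsNP[k notin].
  have edge : box_lo p ka k == P 0 k \/ P 0 k == box_hi p ka k.
    have /andP[kl kh] := PB k; apply/orP; move: notin; apply: contra_notT.
    by rewrite negb_or => /andP[a b]; rewrite !lt_neqAle a kl b kh.
  move: edge; case: (coordinateP k) => [||j] edge.
  - by apply: edge_pos => //; case: edge => /eqP e; [apply: Or41|apply: Or42].
  - by apply: edge_pos => //; case: edge => /eqP e; [apply: Or43|apply: Or44].
  have [u [v [cp Pu Pv Pz]]] := box_point PB.
  have T0 : chebyshev 1 (P 0 (kz j)) m = 0.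
    have m0 : (0 < m)%N by [].
    case: edge => /eqP; rewrite /box_lo /box_hi ?lz ?hz => e.
      by rewrite -e; apply: chebyshev_node_odd.
    have /andP[s0 _] := slot_bounds p ka j; rewrite e.
    have -> : ((slot p ka j).*2.-1 = (slot p ka j).-1.*2.+1)%N by lia.
    exact: chebyshev_node_odd.
  have [G0 _] := plane_sign cp; have [_ _ _ hI] := r_good cp.
  rewrite valueE; apply: ltr_wpDl; first by rewrite /plane_value Pu Pv.
  rewrite pmulr_rgt0// /perturbation_value mulrDr Pu Pv.
  have -> : \sum_(i < J) chebyshev 1 (P 0 (kz i)) m =
      \sum_(i < J | i != j) chebyshev 1 (P 0 (kz i)) m.
    by rewrite (bigD1 j)//= [X in X + _ = _]T0 add0r.
  have : `|sigma p * \sum_(i < J | i != j) chebyshev 1 (P 0 (kz i)) m| <= J%:R - 1.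
    rewrite s_abs; apply: le_trans (ler_norm_sum _ _ _) _.
    apply: le_trans (ler_sum _ (fun i _ => Pz i)) _.
    rewrite sumr_const (cardC1 j) card_ord.
    by rewrite -subn1 natrB// (leq_ltn_trans _ (ltn_ord j)).
  by rewrite ler_norml => /andP[lo _]; lra.
split=> [P PB P0|].
  apply: contrapT => Pout; have := edge_sign P PB Pout.
  by rewrite P0 mulr0 ltxx.
pose C := box_center p ka.
have CB := @box_center_in p ka.
have CB' : in_box (box_lo p ka) (box_hi p ka) C.
  by move=> k; have /andP[/ltW-> /ltW->] := CB k.
have C_neg : sigma p * value (well_form al d) (chart_point C) < 0.
  have [c0 c1 cz] := coordinatesE (U p ^+ m) (V p ^+ m)
    (fun j => chebyshev_node R m (slot p ka j).*2).
  have [_ _ G0] := UV_node p.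
  rewrite valueE /plane_value /perturbation_value /C !mxE c0 c1 G0 mulr0 add0r.
  rewrite pmulr_rlt0// mulrDr al_node mulrA sigma_sqr mul1r.
  (* The slot has the parity opposite to [below p], which gives the extremum
     the sign [- sigma p]. *)
  have -> : \sum_(j < J) chebyshev 1 (box_center p ka 0 (kz j)) m = \sum_(j < J) - sigma p.
    apply: eq_bigr => j _; rewrite mxE cz chebyshev_node_even//.
    rewrite /slot /sigma addSn exprS mulN1r exprD -muln2 mulnC exprM sqrrN.
    by rewrite expr1n expr1n mul1r.
  by rewrite sumr_const card_ord mulrnAr mulrN sigma_sqr mulNrn; lra.
(* The centre of a planar face, where the sign is that of the boundary. *)
pose E : pt := \row_k (if k == kx then box_lo p ka kx else C 0 k).
have EB : in_box (box_lo p ka) (box_hi p ka) E.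
  move=> k; rewrite mxE; case: eqP => [->|_]; last exact: CB'.
  by rewrite lexx; have /andP[l1' l2'] := CB' kx; rewrite (le_trans l1').
have E_pos : 0 < sigma p * value (well_form al d) (chart_point E).
  by apply: edge_pos => //; apply: Or41; rewrite mxE eqxx.
move: C_neg E_pos; rewrite /sigma; case: (below p); rewrite ?mulN1r ?mul1r => cn ep.
  by exists E, C; split=> //; lra.
by exists C, E.
Qed.

End Wells.

(** * Many components in odd degree *)

Lemma card_ordered_pairs k :
  #|{: {p : 'I_k * 'I_k | (p.1 < p.2)%N}}| = 'C(k, 2).
Proof.
rewrite card_sig -sum1_card (eq_bigl (fun p : 'I_k * 'I_k => true && (p.1 < p.2)%N)) //.
rewrite -(pair_big_dep xpredT (fun a b : 'I_k => (a < b)%N) (fun _ _ => 1%N))/=.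
rewrite (exchange_big_dep predT)//= -bin2_sum big_mkord.
apply: eq_bigr => b _; rewrite (big_ord_narrow (ltnW (ltn_ord b))).
by rewrite sum_nat_const card_ord muln1.
Qed.

(** The form may be singular: a small multiple of the Fermat form makes it
    nonsingular and preserves the finitely many isolating boxes. *)
Lemma betti_value_of_boxes (R : realType) (n m : nat) (f : mpoly n.+1 R)
    (I : finType) (lo hi : I -> 'I_n -> R) :
  (0 < m)%N -> f \is ishomog1 m mdeg ->
  (forall i, isolating_box f (lo i) (hi i)) ->
  (forall i j p, in_open_box (lo i) (hi i) p -> in_open_box (lo j) (hi j) p ->
     i = j) ->
  exists2 b, (#|I| <= b)%N & betti_values R n 0 m b.
Proof.
move=> m0 fm isol disj.
have : \forall c \near (0 : R), forall i,
    isolating_box (f + c *: fermat n m R) (lo i) (hi i).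
  apply: (@filter_forall _ _ _ _ (nbhs_filter (0 : R))) => i.
  exact: isolating_box_near.
move=> /nbhs_ballP[e /= e0 near_isol].
have e2 : 0 < e / 2 by rewrite divr_gt0.
have [c /andP[c0 ce] cns] := nonsingular_perturbation m0 fm e2.
have gm : f + c *: fermat n m R \is ishomog1 m mdeg.
  apply: rpredD => //; apply: rpredZ; apply: rpred_sum => l _.
  rewrite dhomogX; apply/eqP.
  suff : mdeg (mnm_muln (mnm1 l : multinom n.+1) m) = m by [].
  by rewrite mdegMn mdeg1 mul1n.
have [|b Ib bb] := components_lower_bound gm cns _ disj.
  by apply: near_isol; rewrite -ball_normE/= sub0r normrN gtr0_norm//; lra.
by exists b => //; exists (f + c *: fermat n m R).
Qed.

(** One well for each node and each choice of [J] extrema of the kind that the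
    node requires. The parameter of the perturbation is common to the finitely
    many boxes. *)
Lemma betti_value_higher (R : realType) (J q : nat) : (0 < q)%N ->
  exists2 b, ('C(q.*2, 2) * q ^ J <= b)%N & betti_values R J.+2 0 q.*2.+1 b.
Proof.
move=> q0; have [U [V [node inj sign interp]]] := @solitary_nodes R q q0.
have [al alP] := interp (fun p => sigma U V p * (J%:R - 2^-1)).
have [r [r0 rgood rsep]] := radius_exists node inj alP.
pose I : finType := ({p : 'I_q.*2 * 'I_q.*2 | (p.1 < p.2)%N} * {ffun 'I_J -> 'I_q})%type.
have edges (i : I) := planar_edge_near node sign r0 rgood i.1 i.2.
have : \forall d \near (0 : R), forall (i : I) (P : 'rV[R]_J.+2),
    in_box (box_lo U V r i.1 i.2) (box_hi U V r i.1 i.2) P ->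
    planar_edge U V r i.1 i.2 P ->
    0 < sigma U V i.1 * value (well_form J al d) (chart_point P).
  exact: (@filter_forall _ _ _ _ (nbhs_filter (0 : R)) edges).
move=> /nbhs_ballP[e /= e0 edge_pos].
have d0 : 0 < e / 2 by rewrite divr_gt0.
have cardI : #|{: I}| = ('C(q.*2, 2) * q ^ J)%N.
  by rewrite card_prod card_ordered_pairs card_ffun !card_ord.
rewrite -cardI.
apply: (@betti_value_of_boxes _ _ _ (well_form J al (e / 2)) _
  (fun i : I => box_lo U V r i.1 i.2) (fun i : I => box_hi U V r i.1 i.2)) => //.
- exact: dhomog_well_form.
- move=> i; apply: (well_isolating q0 node sign alP r0 rgood d0) => P.
  by apply: edge_pos; rewrite -ball_normE/= sub0r normrN gtr0_norm//; lra.
- move=> [p ka] [p' ka'] P /= PB PB'.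
  have [-> kk] := in_box_inj q0 r0 rsep PB PB'.
  by congr (_, _); apply/ffunP.
Qed.

(** On the line, the Chebyshev polynomial changes sign [m] times between
    consecutive extrema, all in the interval from -1 to 1. *)
Lemma betti_value_line (R : realType) (m : nat) : (0 < m)%N ->
  exists2 b, (m <= b)%N & betti_values R 1 0 m b.
Proof.
move=> m0.
pose f : mpoly 2 R := chebyshev (mpolyX R (mnm1 ord0)) (mpolyX R (mnm1 ord_max)) m.
have fE (P : 'rV[R]_1) : value f (chart_point P) = chebyshev 1 (P 0 0) m.
  have := chebyshev_rmorph (meval (chart_point P 0)) (mpolyX R (mnm1 ord0))
    (mpolyX R (mnm1 ord_max)) m.
  rewrite /= !mevalXU !mxE unlift_none.
  have -> : ord_max = fintype.lift ord0 ord0 :> 'I_2 by exact: val_inj.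
  by rewrite liftK.
suff : exists2 b, (#|'I_m| <= b)%N & betti_values R 1 0 m b by rewrite card_ord.
apply: (@betti_value_of_boxes _ _ _ f _
  (fun (i : 'I_m) (_ : 'I_1) => chebyshev_node R m i.+1.*2)
  (fun (i : 'I_m) (_ : 'I_1) => chebyshev_node R m i.*2)) => //.
- by apply: dhomog_chebyshev; rewrite dhomogX; apply/eqP; exact: mdeg1.
- move=> i.
  have lt_node : chebyshev_node R m i.+1.*2 < chebyshev_node R m i.*2.
    by apply: chebyshev_node_decr; have := ltn_ord i; lia.
  have sgn k : chebyshev 1 (chebyshev_node R m k.*2) m != 0.
    by rewrite chebyshev_node_even// signr_eq0.
  split=> [P PB P0 k|].
    have := PB k; rewrite (ord1 k) !lt_neqAle => /andP[-> ->]; rewrite !andbT.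
    move: P0; rewrite fE => P0; apply/andP; split; apply/eqP => e.
      by move: (sgn i.+1); rewrite e P0 eqxx.
    by move: (sgn i); rewrite -e P0 eqxx.
  pose L : 'rV[R]_1 := \row_k chebyshev_node R m i.+1.*2.
  pose H : 'rV[R]_1 := \row_k chebyshev_node R m i.*2.
  have LB : in_box (fun=> chebyshev_node R m i.+1.*2) (fun=> chebyshev_node R m i.*2) L.
    by move=> k; rewrite mxE lexx ltW.
  have HB : in_box (fun=> chebyshev_node R m i.+1.*2) (fun=> chebyshev_node R m i.*2) H.
    by move=> k; rewrite mxE lexx ltW.
  have vL : value f (chart_point L) = - (-1) ^+ i.
    by rewrite fE mxE chebyshev_node_even// exprS mulN1r.
  have vH : value f (chart_point H) = (-1) ^+ i.
    by rewrite fE mxE chebyshev_node_even.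
  case: (boolP (odd i)) => oi; move: vL vH; rewrite -signr_odd ?oi ?(negbTE oi) ?expr1 ?expr0 => vL vH.
    by exists H, L; rewrite vL vH ltrN10 opprK ltr01.
  by exists L, H; rewrite vL vH ltrN10 ltr01.
- move=> i j P /(_ 0) /andP[li hi] /(_ 0) /andP[lj hj].
  have sep (a b : 'I_m) : (a < b)%N ->
      chebyshev_node R m b.*2 <= chebyshev_node R m a.+1.*2.
    rewrite -ltnS ltnS leq_eqVlt => /orP[/eqP ->//|ab].
    by apply/ltW/chebyshev_node_decr; have := ltn_ord b; lia.
  have [ij|ji|/val_inj//] := ltngtP i j.
    by have := lt_le_trans hj (sep _ _ ij) => /(lt_trans li); rewrite ltxx.
  by have := lt_le_trans hi (sep _ _ ji) => /(lt_trans lj); rewrite ltxx.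
Qed.

Lemma betti_value_lower_bound (R : realType) (n q : nat) : (0 < n)%N -> (0 < q)%N ->
  exists2 b, (q.*2.-1 * q ^ n.-1 <= b)%N & betti_values R n 0 q.*2.+1 b.
Proof.
case: n => [//|[|J]] _ q0.
  have [//|b mb bb] := @betti_value_line R q.*2.+1; exists b => //.
  by rewrite /= expn0 muln1 (leq_trans _ mb)//; lia.
have [b Cb bb] := @betti_value_higher R J q q0; exists b => //.
apply: leq_trans Cb; rewrite /= expnS mulnA leq_mul2r; apply/orP; right.
by rewrite bin2 -[X in (_ <= X)%N]/(_./2) -doubleMl doubleK mulnC.
Qed.

(** * The limit along odd degrees *)

(** For [m = 2 k + 1] and [h = 1 / m], the integers [k] and [2 k - 1] are [m (1
    - h) / 2] and [m (1 - 2 h)]; here [k] is [q + 1]. *)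
Lemma odd_degree_ratio (R : realType) (n q : nat) :
  let h := harmonic q.+1.*2 in
  (1 - 2 * h) * ((1 - h) / 2) ^+ n =
  (q.+1.*2.-1 * q.+1 ^ n)%:R / (q.+1.*2.+1%:R : R) ^+ n.+1.
Proof.
move=> h; have mE : q.+1.*2.+1%:R = 2 * q.+1%:R + 1 :> R.
  by rewrite -addn1 natrD -muln2 natrM mulrC.
have m0 : q.+1.*2.+1%:R != 0 :> R by rewrite pnatr_eq0.
have -> : 1 - 2 * h = q.+1.*2.-1%:R / q.+1.*2.+1%:R.
  have -> : q.+1.*2.-1%:R = 2 * q.+1%:R - 1 :> R.
    by rewrite doubleS/= -!natr1 -muln2 natrM; ring.
  by move: m0; rewrite /h /harmonic/= mE => m0; field.
have -> : (1 - h) / 2 = q.+1%:R / q.+1.*2.+1%:R.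
  by move: m0; rewrite /h /harmonic/= mE => m0; field.
by rewrite expr_div_n natrM natrX exprS mulf_div.
Qed.

Theorem proposition3p5 (R : realType) (n : nat) (zeta : R) :
  (1 <= n)%N -> is_zeta 0 n zeta -> 1 / 2 ^+ (n - 1) <= zeta.
Proof.
case: n => [//|n] _ [M maxM limM]; rewrite subn1/=.
have to_oo : (q.+1.*2 @[q --> \oo] --> \oo)%classic.
  apply/cvgnyPge => A; exists A => // q /= Aq; lia.
have to_oo1 : (q.+1.*2.+1 @[q --> \oo] --> \oo)%classic.
  apply/cvgnyPge => A; exists A => // q /= Aq; lia.
have lim_odd := cvg_comp _ _ to_oo1 limM.
have lim_h := cvg_comp _ _ to_oo (@cvg_harmonic R).
have lim_ratio : ((1 - 2 * harmonic q.+1.*2) * ((1 - harmonic q.+1.*2) / 2) ^+ n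
    @[q --> \oo] --> ((1 - 2 * 0) * ((1 - 0) / 2) ^+ n : R))%classic.
  apply: cvgM.
    by apply: cvgB; [exact: cvg_cst|apply: cvgM => //; exact: cvg_cst].
  have lim_base : ((1 - harmonic q.+1.*2) / 2 @[q --> \oo] --> ((1 - 0) / 2 : R))%classic.
    by apply: cvgM; [apply: cvgB => //; exact: cvg_cst|exact: cvg_cst].
  exact: (cvg_comp _ _ lim_base (@exprn_continuous R n _)).
have -> : 1 / 2 ^+ n = (1 - 2 * 0) * ((1 - 0) / 2) ^+ n :> R.
  by rewrite mulr0 !subr0 !mul1r exprVn.
apply: (ler_cvg_to lim_ratio lim_odd); near=> q.
rewrite odd_degree_ratio /= ler_wpM2r ?invr_ge0 ?exprn_ge0// ler_nat.
have [b lb bb] := @betti_value_lower_bound R n.+1 q.+1 isT isT.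
by apply: leq_trans lb _; exact: (maxM q.+1.*2.+1 isT).2.
Unshelve. all: by end_near. Qed.
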